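(* Let $I$ be a non-empty open interval of $\mathbb{R}$, let $\lambda_1,\lambda_2$ be probability measures on $\mathcal{B}_I$ of finite mean which are in convex order, and let $f:I\to\mathbb{R}$ be concave with $\int f^-\,d\lambda_2<\infty$. Assume the support of $\lambda_1$ is the finite set $\{a_1,\ldots,a_n\}$ of cardinality $n\in\mathbb{N}$. Let $\mathcal{M}$ be the set of martingale transports of $\lambda_1$ to $\lambda_2$ and, for $\nu\in\mathcal{M}$ and $i\in\{1,\ldots,n\}$, let $\nu_i:=\nu(X_2\in\cdot\mid X_1=a_i)$. Then $$\mathcal{X}:=\Big\{\Big(\int f\,d\nu_1,\ldots,\int f\,d\nu_n\Big):\nu\in\mathcal{M}\Big\}$$ is a convex compact subset of $\mathbb{R}^n$, and it is equal to the convex hull of $$\mathcal{E}:=\Big\{\Big(\int f\,d\nu_1,\ldots,\int f\,d\nu_n\Big):\nu\text{ a curtain martingale transport of }\lambda_1\text{ to }\lambda_2\Big\}.$$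
   Context: $\mathcal{B}_A$ denotes the Borel $\sigma$-field of $A$. $X_1,X_2$ are the canonical projections of $I^2$ onto the first and second coordinate. Convex order: probability measures $\lambda_1,\lambda_2$ on $\mathcal{B}_I$ of finite mean are in convex order if $\int\psi\,d\lambda_1\le\int\psi\,d\lambda_2$ for all convex $\psi:I\to\mathbb{R}$. A martingale transport (or coupling) of $\lambda_1$ to $\lambda_2$ is a probability measure $\nu$ on $\mathcal{B}_{I^2}$ with first marginal $\lambda_1$, second marginal $\lambda_2$ and $E_\nu[X_2\mid X_1]=X_1$ $\nu$-a.s. A curtain martingale transport of $\lambda_1$ to $\lambda_2$ is a martingale transport $\nu$ of $\lambda_1$ to $\lambda_2$ for which there exists $\Gamma\in\mathcal{B}_{I^2}$ that carries $\nu$ (i.e. $\nu(\Gamma)=1$) and such that one cannot have $\{(x,y),(x,y_1),(x,y_2),(x',y'),(x',y_1'),(x',y_2')\}\subset\Gamma$ with $x\ne x'$, $y_1<y'<y_2$ and $y_1'<y<y_2'$. *)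

(* Defs.v *)
From HB Require Import structures.
From mathcomp Require Import all_boot all_order all_algebra.
From mathcomp Require Import all_classical all_reals all_analysis.

Set Implicit Arguments.
Unset Strict Implicit.
Unset Printing Implicit Defensive.

Import Order.TTheory GRing.Theory Num.Theory.
Import numFieldNormedType.Exports.

Local Open Scope classical_set_scope.
Local Open Scope ring_scope.

(* The state space is an interval [I : set R]. A probability measure on the
   Borel sigma-field of [I] is encoded as a Borel probability measure [lambda]
   on R with [lambda I = 1], and a function I -> R as a function R -> R of which
   only the restriction to [I] is ever used: integrals are taken over [I] and
   convexity is required on [I]. Marginals carried by [I] force a
   measure on R * R to be carried by I * I, so couplings need no separate
   support condition. *)

Section measures.
Context {R : realType}.
Local Notation RR := (measurableTypeR R).
Implicit Types (I : set R) (lambda : probability RR R)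
  (nu : probability (RR * RR)%type R).

Definition finite_mean I lambda : Prop :=
  lambda.-integrable I (fun x : R => x%:E).

(* For [lambda1], [lambda2] of finite mean both integrals are well defined in
   ]-oo, +oo]. *)
Definition convex_order I lambda1 lambda2 : Prop :=
  forall psi : R -> R, convex_function (I : set R^o) (psi : R^o -> R^o) ->
    (\int[lambda1]_(x in I) (psi x)%:E <= \int[lambda2]_(x in I) (psi x)%:E)%E.

(* The topological support relative to [I]; since [I] is open, neighbourhoods
   in R and in [I] give the same notion for a measure carried by [I]. *)
Definition msupport I lambda : set R :=
  [set x | I x /\ forall U : set R, open U -> U x -> (0 < lambda U)%E].

(* [Z] is a version of the conditional expectation E_P[Y | X]. *)
Definition is_condexp d (T : measurableType d) (P : probability T R)
    (X Y Z : T -> R) : Prop :=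
  let G := g_sigma_algebra_preimage (X : T -> RR) in
  [/\ P.-integrable setT (EFin \o Y),
      P.-integrable setT (EFin \o Z),
      (forall B : set RR, measurable B -> G (Z @^-1` B)) &
      (forall A : set T, G A ->
        \int[P]_(w in A) (Z w)%:E = \int[P]_(w in A) (Y w)%:E)%E].

Definition martingale_transport lambda1 lambda2 nu : Prop :=
  [/\ (forall B : set RR, measurable B -> nu (fst @^-1` B) = lambda1 B),
      (forall B : set RR, measurable B -> nu (snd @^-1` B) = lambda2 B) &
      exists2 Z : R * R -> R,
        is_condexp nu fst snd Z & {ae nu, forall w, Z w = w.1}].

Definition curtain_set (Gamma : set (R * R)) : Prop :=
  forall x y y1 y2 x' y' y1' y2' : R,
    ~ [/\ [set (x, y); (x, y1); (x, y2); (x', y'); (x', y1'); (x', y2')]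
            `<=` Gamma,
          x != x', y1 < y' < y2 & y1' < y < y2'].

Definition curtain_martingale_transport I lambda1 lambda2 nu : Prop :=
  martingale_transport lambda1 lambda2 nu /\
  exists Gamma : set (RR * RR)%type,
    [/\ measurable Gamma, Gamma `<=` I `*` I, nu Gamma = 1%E &
        curtain_set Gamma].

(* [cond_law nu a] is nu(X_2 \in . | X_1 = a), meaningful when
   nu(X_1 = a) > 0; otherwise it is the zero measure. *)
Definition cond_law nu (a : R) (B : set RR) : \bar R :=
  (((fine (nu (fst @^-1` [set a])))^-1)%:E
    * nu (fst @^-1` [set a] `&` snd @^-1` B))%E.

Section cond_law_measure.
Variables (nu : probability (RR * RR)%type R) (a : R).

Let mD : measurable (fst @^-1` [set a] : set (RR * RR)%type).
Proof. by rewrite -[X in measurable X]setTI; exact: measurable_fst. Qed.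

Let cond_law0 : cond_law nu a set0 = 0%E.
Proof. by rewrite /cond_law preimage_set0 setI0 measure0 mule0. Qed.

Let cond_law_ge0 B : (0 <= cond_law nu a B)%E.
Proof. by rewrite mule_ge0// lee_fin invr_ge0 fine_ge0. Qed.

Let cond_law_sigma_additive : semi_sigma_additive (cond_law nu a).
Proof.
move=> F mF tF mUF.
have mS (B : set RR) : measurable B ->
    measurable (snd @^-1` B : set (RR * RR)%type).
  by move=> mB; rewrite -[X in measurable X]setTI; exact: measurable_snd.
rewrite [X in X @ _ --> _](_ : _ = (fun n =>
    ((fine (nu (fst @^-1` [set a])))^-1)%:E
      * \sum_(0 <= i < n) nu (fst @^-1` [set a] `&` snd @^-1` (F i)))%E).
  apply: cvgeZl => //; rewrite preimage_bigcup setI_bigcupr.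
  apply: measure_semi_sigma_additive.
  - by move=> n; apply: measurableI => //; exact: mS.
  - apply/trivIsetP => i j _ _ ij; rewrite setIACA setIid -preimage_setI.
    move/trivIsetP : tF => /(_ i j Logic.I Logic.I ij) ->.
    by rewrite preimage_set0 setI0.
  - rewrite -setI_bigcupr -preimage_bigcup.
    by apply: measurableI => //; exact: mS.
by apply/funext => n; rewrite ge0_sume_distrr.
Qed.

HB.instance Definition _ := isMeasure.Build _ _ _
  (cond_law nu a) cond_law0 cond_law_ge0 cond_law_sigma_additive.

End cond_law_measure.

Definition cond_integrals (I : set R) (f : R -> R) n (a : 'I_n -> R) nu :
    'rV[R]_n :=
  \row_i \int[cond_law nu (a i)]_(x in I) f x.

End measures.

Definition convex_hull (R : numDomainType) (M : lmodType R) (A : set M) : set M :=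
  smallest (@convex_set R M) A.

(* Main.v *)
(** Since [lambda1] has finitely many atoms [a_i], of masses [p_i], a martingale
    transport amounts to measurable densities [g_i >= 0] with respect to
    [lambda2] such that [g_1 + ... + g_n = 1], [\int g_i = p_i] and
    [\int y g_i = p_i a_i], and its value is [(p_i^-1 \int f g_i)_i]. Along an
    ultrafilter the masses [\int_A g_i] converge to a measure dominated by
    [lambda2], hence with a density: such families are weakly compact, so the
    set [X] of values is compact and convex, and by Minkowski's theorem it
    suffices to realize each extreme point [e] of [X] by a curtain transport.

    Suppose [y1 < y < y2] with [y1], [y2] in the support of the strip over [a_i]
    and [y] in that of the strip over [a_j]. Exchanging mass near [y1] and [y2]
    for mass near [y], with totals and barycentres kept, moves the value by
    [delta (p_i^-1 e_i - p_j^-1 e_j)], where [delta >= 0] by concavity. As [e] is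
    extreme, "some positive multiple of [p_i^-1 e_i - p_j^-1 e_j] can be added
    to [e] within [X]" is a partial order on indices. Let [c] be an injective
    increasing real function for it and, among the transports of value [e],
    maximize [\sum_i c_i \int F g_i] with [F] strictly concave. The exchange then
    forces [c_i < c_j]: by monotonicity of [c] if [delta > 0], by maximality if
    [delta = 0]. The two interlacing configurations forbidden in a curtain set
    would give both [c_i < c_j] and [c_j < c_i]. *)

Require Import Defs.
From HB Require Import structures.
From mathcomp Require Import all_boot all_order all_algebra.
From mathcomp Require Import all_classical all_reals all_analysis.
From mathcomp Require Import measurable_realfun ring lra.

Set Implicit Arguments.
Unset Strict Implicit.
Unset Printing Implicit Defensive.

Import Order.TTheory GRing.Theory Num.Theory.
Import numFieldNormedType.Exports.

Local Open Scope classical_set_scope.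
Local Open Scope ring_scope.

(** * Minkowski's theorem *)

Section extreme_points.
Context {R : realType}.

Lemma convex_setP (M : lmodType R) (A : set M) : convex_set A <->
  forall x y t, A x -> A y -> 0 <= t -> t <= 1 -> A (t *: x + (1 - t) *: y).
Proof.
split=> [cA x y t Ax Ay t0 t1|cA x y t /set_mem Ax /set_mem Ay].
  by have /set_mem := cA x y (Itv01 t0 t1) (mem_set Ax) (mem_set Ay).
by apply/mem_set; exact: cA.
Qed.

Variable n : nat.
Implicit Types (K C : set 'rV[R]_n) (x v w e : 'rV[R]_n).

(** Extremality in midpoint form: [e] is not the centre of a nondegenerate segment of [K]. For
    convex [K] this is the usual notion. *)
Definition extreme_point K e :=
  K e /\ forall v, K (e + v) -> K (e - v) -> v = 0.

(* The direction space of the face of [K] generated by [x]. *)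
Let face K x v := exists2 t, 0 < t & K (x + t *: v) /\ K (x - t *: v).

Let face0 K x : K x -> face K x 0.
Proof. by move=> Kx; exists 1 => //; rewrite !scaler0 addr0 subr0. Qed.

Let faceZ K x c v : K x -> face K x v -> face K x (c *: v).
Proof.
move=> Kx [t t0 [Kp Km]].
have [->|c0] := eqVneq c 0; first by rewrite scale0r; exact: face0.
exists (t / `|c|); first by rewrite divr_gt0 ?normr_gt0.
have [cp|cn|ce] := ltgtP 0 c; last by rewrite -ce eqxx in c0.
  by rewrite gtr0_norm// scalerA divfK ?gt_eqF.
rewrite ltr0_norm// scalerA invrN mulrN mulNr divfK ?lt_eqF//.
by rewrite scaleNr opprK.
Qed.

(** The weights [s / (t + s)] and [t / (t + s)] balance the two step lengths: combining [x + t v]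
    with [x + s w], and likewise with minus signs, gives [x] plus or minus the same multiple of
    [v + w]. *)
Let faceD K x v w : convex_set K -> face K x v -> face K x w ->
  face K x (v + w).
Proof.
move=> /convex_setP cK [t t0 [Kp Km]] [s s0 [Lp Lm]].
have ts0 : 0 < t + s by rewrite addr_gt0.
exists (t * s / (t + s)); first by rewrite divr_gt0 ?mulr_gt0.
have sE : 1 - s / (t + s) = t / (t + s).
  by field; rewrite gt_eqF.
have s1 : s / (t + s) <= 1 by rewrite ler_pdivrMr// mul1r lerDr ltW.
have s2 : 0 <= s / (t + s) by rewrite divr_ge0 ?ltW.
have /= := cK _ _ _ Kp Lp s2 s1; have /= := cK _ _ _ Km Lm s2 s1.
suff E (u : R) : (s / (t + s)) *: (x + (u * t) *: v) +
    (t / (t + s)) *: (x + (u * s) *: w) = x + u *: ((t * s / (t + s)) *: (v + w)).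
  move: (E 1) (E (-1)).
  by rewrite sE !mul1r !mulN1r !scale1r !scaleN1r !scaleNr => -> ->.
by apply/rowP => i; rewrite !mxE; field; rewrite gt_eqF.
Qed.

Let face_submx K x m (A : 'M[R]_(m, n)) v : K x -> convex_set K ->
  (forall i, face K x (row i A)) -> (v <= A)%MS -> face K x v.
Proof.
move=> Kx cK Af /submxP[u ->]; rewrite mulmx_sum_row.
elim/big_ind : _ => [|w1 w2|i _]; [exact: face0|exact: faceD|exact: faceZ].
Qed.

(** The parameters [s] with [x + s v] in [K] form a closed bounded set, so their supremum is
    attained. *)
Let far_point K x v : compact K -> K x -> v != 0 ->
  exists2 t, 0 <= t & K (x + t *: v) /\ forall s, t < s -> ~ K (x + s *: v).
Proof.
move=> Kc Kx v0.
pose L : R -> 'rV[R]_n := fun s => x + s *: v.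
pose S := L @^-1` K.
have S0 : S 0 by rewrite /S /L/= scale0r addr0.
have Lcont : continuous L.
  move=> s; apply: (@cvgD _ _ _ _ _ (cst x) ( *:%R^~ v)); first exact: cvg_cst.
  by apply: (@cvgZr_tmp _ _ _ _ _ id); exact: cvg_id.
have Scl : closed S.
  apply: closed_comp => [s _|]; first exact: Lcont.
  exact: compact_closed (@norm_hausdorff _ _) Kc.
have [M [Mr KM]] := compact_bounded Kc.
have vn : 0 < `|v| by rewrite normr_gt0.
have Sub : ubound S ((`|M| + 1 + `|x|) / `|v|).
  move=> s /KM /= /(_ (`|M| + 1)) h.
  rewrite ler_pdivlMr//; apply: (@le_trans _ _ `|s *: v|).
    by rewrite normrZ ler_wpM2r// ler_norm.
  rewrite -[s *: v](addKr x) (le_trans (ler_normD _ _))// normrN addrC lerD2r.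
  by apply: h; rewrite (le_lt_trans (ler_norm _))// ltrDl.
have Ssup : has_sup S by split; [exists 0|exists ((`|M| + 1 + `|x|) / `|v|)].
have SsupS : S (sup S).
  by apply: Scl; exact: closure_sup (Ssup.1) (Ssup.2).
exists (sup S); first exact: (sup_upper_bound Ssup) S0.
split=> // s ss Ks.
by have := sup_upper_bound Ssup Ks; rewrite leNgt ss.
Qed.

(** Minkowski's theorem by induction on the dimension of the face of [x]. A point that is not
    extreme lies on a chord whose two ends have faces of smaller dimension, and convexity of [C]
    brings the conclusion back from the ends to [x]. *)
Lemma compact_convex_sub K C : compact K -> convex_set K -> convex_set C ->
  extreme_point K `<=` C -> K `<=` C.
Proof.
move=> Kc cK cC KC.
(* The dimension of the face enters only through a bound [d] on the rank of the matrices with rows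
   in its direction space. *)
suff rec d : forall x, K x -> (forall m (A : 'M[R]_(m, n)),
    (forall i, face K x (row i A)) -> (\rank A <= d)%N) -> C x.
  by move=> x Kx; apply: (rec n) => // m A _; exact: rank_leq_col.
elim: d => [|d IH] x Kx Ax.
  apply: KC; split => // v Kp Km.
  have /Ax : forall i : 'I_1, face K x (row i v).
    by move=> i; rewrite row_id; exists 1 => //; rewrite scale1r.
  by rewrite leqn0 mxrank_eq0 => /eqP.
have [Kex|] := pselect (extreme_point K x); first exact: KC.
move=> /not_andP[//|/existsNP[v0 /not_implyP[Kp /not_implyP[Km /eqP vn0]]]].
have cC' := (convex_setP _).1 cC; have cK' := (convex_setP _).1 cK.
(* [d] drops at an end point [x + t v0] of the chord of [K] through [x]. *)
have step v t t' : v != 0 -> K (x + v) -> K (x - v) -> 1 <= t ->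
    K (x + t *: v) -> (forall s, t < s -> ~ K (x + s *: v)) ->
    C (x + t *: v).
  move=> v'0 Kxp Kxm t1 Kt tmax.
  have t0 : 0 < t by rewrite (lt_le_trans ltr01).
  have fv : face K x v by exists 1 => //; rewrite scale1r.
  (* [x] lies strictly between [x + t v] and [x - v], with weights [1 / (1 + t)] and [t / (1 + t)];
     averaging with [x - v] carries a direction at the end point back to [x], scaled by
     [1 / (1 + t)]. *)
  have sub w : face K (x + t *: v) w -> face K x w.
    move=> [s s0 [sp sm]].
    have u0 : 0 < 1 + t by rewrite addr_gt0.
    exists (s / (1 + t)); first by rewrite divr_gt0.
    have h1 : 0 <= (1 + t)^-1 by rewrite invr_ge0 ltW.
    have h2 : (1 + t)^-1 <= 1 by rewrite invf_le1// lerDl ltW.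
    have := cK' _ _ _ sp Kxm h1 h2; have := cK' _ _ _ sm Kxm h1 h2.
    have E (r : R) : (1 + t)^-1 *: (x + t *: v + (r * s) *: w) + (1 - (1 +
      t)^-1) *: (x - v) =
        x + r *: ((s / (1 + t)) *: w).
      have -> : 1 - (1 + t)^-1 = t / (1 + t) by field; rewrite gt_eqF.
      apply/rowP => i; rewrite !mxE; field; by rewrite gt_eqF.
    move: (E 1) (E (-1)); rewrite !mul1r !scale1r mulN1r scaleN1r scaleNr => ->
      ->.
    by [].
  apply: IH => // m A Af; rewrite -ltnS.
  (* Adding the row [v] raises the rank strictly: were [v] in the row space of [A], it would be a
     direction of the face at the end point, and the chord could be prolonged past [t]. *)
  have AvF : forall i, face K x (row i (col_mx v A)).
    move=> i; case: (split_ordP i) => j ->; rewrite ?rowKu ?rowKd.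
      by rewrite row_id.
    exact/sub/Af.
  apply: leq_trans (Ax _ _ AvF); apply: rank_ltmx; rewrite ltmxE.
  apply/andP; split.
    by have := submx_refl (col_mx v A); rewrite col_mx_sub => /andP[].
  apply/negP; rewrite col_mx_sub => /andP[vA _].
  have [r r0 [+ _]] := face_submx Kt cK Af vA.
  rewrite -addrA -scalerDl => /(tmax _ _); apply.
  by rewrite ltrDl.
have ext v : v != 0 -> K (x + v) -> K (x - v) ->
    exists2 t, 1 <= t & C (x + t *: v).
  move=> v'0 Kxp Kxm; have [t t0 [Kt tmax]] := far_point Kc Kx v'0.
  have t1 : 1 <= t.
    by rewrite leNgt; apply/negP => /tmax; rewrite scale1r.
  by exists t => //; exact: step.
(* The two ends of the chord, along [v0] and along [- v0]; [x] is their barycentre with weights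
   [u / (u + t)] and [t / (u + t)]. *)
have [t t1 Ct] := ext _ vn0 Kp Km.
have [|||u u1 Cu] := ext (- v0); rewrite ?oppr_eq0 ?opprK//.
have tu0 : 0 < u + t by rewrite addr_gt0// (lt_le_trans ltr01).
have h0 : 0 <= u / (u + t) by rewrite divr_ge0 ?ltW// (lt_le_trans ltr01).
have h1 : u / (u + t) <= 1.
  by rewrite ler_pdivrMr// mul1r lerDl ltW// (lt_le_trans ltr01).
suff -> : x = (u / (u + t)) *: (x + t *: v0) +
    (1 - u / (u + t)) *: (x + u *: - v0) by exact: cC'.
by apply/rowP => i; rewrite !mxE; field; rewrite gt_eqF.
Qed.

End extreme_points.

(** * Densities and weak compactness *)

Lemma ultra_fmap (S S' : Type) (f : S -> S') (U : set_system S) :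
  UltraFilter U -> UltraFilter (f @ U).
Proof.
move=> UU; split; first exact: fmap_proper_filter.
move=> G GF fUG; rewrite eqEsubset; split=> // A GA.
have [//|UnA] := in_ultra_setVsetC (f @^-1` A) UU.
have GnA : G (~` A) by exact: fUG.
by have /filter_ex[? []] : G (A `&` ~` A) by exact: filterI.
Qed.

Section densities.
Context d (T : measurableType d) (R : realType).
Local Open Scope ereal_scope.

(** Having the same integrals over measurable sets, [h] and the Radon-Nikodym derivative agree
    almost everywhere, so the change of variables known for the derivative holds with [h]. *)
Let finite_measure_density (m : {finite_measure set T -> \bar R})
    (P : {finite_measure set T -> \bar R}) (h : T -> R) :
  measurable_fun setT h -> (forall x, 0 <= h x)%R ->
  (forall A, measurable A -> m A = \int[P]_(x in A) (h x)%:E) ->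
  forall (E : set T) (f : T -> \bar R), measurable E ->
    (forall x, 0 <= f x) -> measurable_fun E f ->
    \int[m]_(x in E) f x = \int[P]_(x in E) (f x * (h x)%:E).
Proof.
move=> mh h0 mP E f mE f0 mf.
have dom : m `<< P.
  apply/null_content_dominatesP => A mA PA0; rewrite mP//.
  by apply: null_set_integral => //; apply/measurable_EFinP/measurable_funTS.
rewrite -(Radon_Nikodym_SigmaFinite.change_of_variables dom)//.
have mrn := measurable_int _ (Radon_Nikodym_SigmaFinite.f_integrable dom).
have mhE : measurable_fun setT (EFin \o h) by exact/measurable_EFinP.
apply: ae_eq_integral => //.
- by apply: emeasurable_funM => //; exact: measurable_funTS.
- by apply: emeasurable_funM => //; exact: measurable_funTS.
apply: ae_eqe_mul2l; apply: (@ae_eq_subset _ _ _ _ P setT) => //.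
apply: integral_ae_eq => //.
  exact: Radon_Nikodym_SigmaFinite.f_integrable.
by move=> A _ mA; rewrite -Radon_Nikodym_SigmaFinite.f_integral// mP.
Qed.

Variable P : {finite_measure set T -> \bar R}.

(** The bound is 1 for the strips of a coupling and the inverse of an atom mass for conditional
    laws. *)
Definition bdd_density (M : R) (h : T -> R) :=
  measurable_fun setT h /\ forall x, (0 <= h x <= M)%R.

Lemma bdd_density_integrable M h : bdd_density M h ->
  P.-integrable setT (EFin \o h).
Proof.
move=> [mh h01].
apply: (@le_integrable _ _ _ P _ measurableT _ (cst `|M|%:E)).
- exact/measurable_EFinP.
- move=> x _ /=; have /andP[h0 hM] := h01 x.
  by rewrite normr_id lee_fin ger0_norm// (le_trans hM)// ler_norm.
- exact: finite_measure_integrable_cst.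
Qed.

Lemma integrableM_density (E : set T) (f : T -> R) M h : measurable E ->
  bdd_density M h -> P.-integrable E (EFin \o f) ->
  P.-integrable E (EFin \o (f \* h)%R).
Proof.
move=> mE [mh h01] intf.
apply: (le_integrable mE _ _ (integrableZl mE `|M| intf)).
  apply/measurable_EFinP/measurable_funM; last exact: measurable_funTS.
  exact/measurable_EFinP/(measurable_int P).
move=> x _ /=; rewrite lee_fin !normrM mulrC ler_wpM2r// normr_id.
by have /andP[h0 hM] := h01 x; rewrite ger0_norm// (le_trans hM)// ler_norm.
Qed.

Section density_of_measure.
Variable m : {measure set T -> \bar R}.

Lemma ge0_integral_density M (h : T -> R) : bdd_density M h ->
  (forall A, measurable A -> m A = \int[P]_(x in A) (h x)%:E) ->
  forall (E : set T) (f : T -> \bar R), measurable E ->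
    (forall x, 0 <= f x) -> measurable_fun E f ->
    \int[m]_(x in E) f x = \int[P]_(x in E) (f x * (h x)%:E).
Proof.
move=> hd mP E f mE f0 mf; have moo : m setT < +oo.
  by rewrite mP//; apply: integrable_lty => //;
    exact: (bdd_density_integrable hd).
(* Restriction to the whole space turns [m] into a finite measure with the same values. *)
rewrite (eq_measure_integral (mfrestr measurableT moo)); last first.
  by move=> A mA _; rewrite /= /mfrestr /mrestr setIT.
apply: finite_measure_density => //; [by case: hd|by move=> x;
  case: hd => _ /(_ x)/andP[]|].
by move=> A mA; rewrite /= /mfrestr /mrestr setIT mP.
Qed.

Lemma integral_density M (h : T -> R) : bdd_density M h ->
  (forall A, measurable A -> m A = \int[P]_(x in A) (h x)%:E) ->
  forall (E : set T) (f : T -> R), measurable E ->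
    P.-integrable E (EFin \o f) ->
    m.-integrable E (EFin \o f) /\
    \int[m]_(x in E) (f x)%:E = \int[P]_(x in E) (f x * h x)%:E.
Proof.
move=> hd mP E f mE intf; have mf := measurable_int _ intf.
have h0 x : (0 <= h x)%R by case: hd => _ /(_ x)/andP[].
have intfh := integrableM_density mE hd intf.
split.
  apply/integrableP; split=> //.
  rewrite (ge0_integral_density hd mP)//; last exact: measurableT_comp.
  case/integrableP : intfh => _; apply: le_lt_trans.
  rewrite le_eqVlt; apply/predU1P; left; apply: eq_integral => x _ /=.
  by rewrite normrM [X in _ = (_ * X)%:E]ger0_norm.
rewrite integralE [RHS]integralE.
rewrite (ge0_integral_density hd mP)//; last exact: measurable_funepos.
rewrite (ge0_integral_density hd mP)//; last exact: measurable_funeneg.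
congr (_ - _); apply: eq_integral => x _.
  by rewrite !funeposE/= -!EFin_max -EFinM maxr_pMl// mul0r.
by rewrite !funenegE/= -!EFin_max -EFinM maxr_pMl// mul0r mulNr.
Qed.

(** The Radon-Nikodym derivative is at most 1 only almost everywhere; truncating it at 1 makes the
    bound hold at every point. *)
Lemma dominated_density : (forall A, measurable A -> m A <= P A) ->
  exists2 h, bdd_density 1 h &
    forall A, measurable A -> m A = \int[P]_(x in A) (h x)%:E.
Proof.
move=> mP.
have moo : m setT < +oo.
  by rewrite (le_lt_trans (mP _ measurableT))// ltey_eq fin_num_measure.
pose m' : {finite_measure set T -> \bar R} := mfrestr measurableT moo.
have m'E A : m' A = m A by rewrite /m' /= /mfrestr /mrestr setIT.
have dom : m' `<< P.
  apply/null_content_dominatesP => A mA PA0.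
  by apply/eqP; rewrite eq_le measure_ge0 andbT -PA0 m'E mP.
have [h [h0 hfin inth hE']] := radon_nikodym_sigma_finite dom.
have mh := measurable_int _ inth.
have hE A : measurable A -> m A = \int[P]_(x in A) h x by rewrite -m'E;
  exact: hE'.
pose k x := Num.min (fine (h x)) 1%R.
have mk : measurable_fun setT k.
  by apply: measurable_minr => //;
    exact: (measurableT_comp (fine_measurable measurableT)).
have k01 : bdd_density 1 k.
  split=> // x; rewrite /k le_min fine_ge0//= ler01/=.
  by rewrite ge_min lexx orbT.
exists k => // A mA.
(* On subsets of [D] the derivative exceeds 1 while [m <= P], so [m] and [P] coincide there and the
   truncated value 1 is the right density. *)
pose D := [set x | 1 < h x].
have mD : measurable D.
  by rewrite /D -[X in measurable X]setTI; exact: emeasurable_fun_o_infty.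
have mAD : measurable (A `&` D) by exact: measurableI.
have mADC : measurable (A `\` D) by exact: measurableD.
have intk := bdd_density_integrable k01.
have UAD : A = (A `&` D) `|` (A `\` D) by rewrite setUIDK.
rewrite UAD measureU//; last by apply/seteqP; split=> x // [[_ Dx] []].
rewrite integral_setU//; last 2 first.
- exact/measurable_funTS/measurable_EFinP.
- by apply/disj_setPS => x [[_ ?] []].
congr (_ + _).
- have -> : \int[P]_(x in A `&` D) (k x)%:E = P (A `&` D).
    rewrite -[RHS]mul1e -integral_cst//;
      apply: eq_integral => x /set_mem[_ /= h1].
    rewrite /k min_r// -lee_fin fineK//; exact: ltW.
  apply/eqP; rewrite eq_le mP//= hE// -[P _]mul1e -integral_cst//.
  apply: ge0_le_integral => //; last by move=> x [_ /ltW].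
  exact: measurable_funTS.
- transitivity (\int[P]_(x in A `\` D) h x); first exact: hE.
  apply: eq_integral => x /set_mem[_ /negP].
  rewrite -leNgt => h1; rewrite /k min_l ?fineK// -lee_fin fineK//.
Qed.

End density_of_measure.
End densities.

Notation unit_density := (bdd_density 1).

Lemma cvg_sum_ord (R : realType) S (F : set_system S) {FF : Filter F} n
    (f : 'I_n -> S -> R) (l : 'I_n -> R) :
  (forall i, f i s @[s --> F] --> l i) ->
  \sum_i f i s @[s --> F] --> \sum_i l i.
Proof.
elim: n f l => [|n IH] f l fl.
  rewrite big_ord0; under eq_fun do rewrite big_ord0; exact: cvg_cst.
rewrite big_ord_recr; under eq_fun do rewrite big_ord_recr.
by apply: cvgD => //; exact: IH.
Qed.

(** * Weak limits of densities along an ultrafilter *)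

Section weak_limit.
Import HBSimple.
Context d (T : measurableType d) (R : realType)
  (P : {finite_measure set T -> \bar R}).
Implicit Types (f g : T -> R).

Lemma normr_int_density f (h : T -> R) : P.-integrable setT (EFin \o f) ->
  unit_density h -> `|\int[P]_x (f x * h x)| <= \int[P]_x `|f x|.
Proof.
move=> intf hd; have intfh := integrableM_density measurableT hd intf.
apply: le_trans (le_normr_Rintegral measurableT intfh) _.
apply: le_Rintegral => //; [exact: integrable_norm..|].
move=> x _; rewrite /= normrM ler_piMr//.
by have [_ /(_ x)/andP[h0 h1]] := hd; rewrite ger0_norm.
Qed.

Section linear_limit.
Variables (S : Type) (U : set_system S) (h : S -> T -> R).
Hypotheses (UU : UltraFilter U) (hd : forall s, unit_density (h s)).

Let J f s := \int[P]_x (f x * h s x).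
Let L f := lim (J f @ U).
Let Int f := P.-integrable setT (EFin \o f).

Let Jint f s : Int f -> P.-integrable setT (EFin \o (f \* h s)).
Proof. by move=> If; exact: (integrableM_density measurableT (hd s)). Qed.

Let Jnorm f s : Int f -> `|J f s| <= \int[P]_x `|f x|.
Proof. by move=> intf; exact: normr_int_density. Qed.

(** The values [J f s] stay in a compact segment given by the L^1 norm of [f], where the image
    ultrafilter must converge. *)
Let Jcvg f : Int f -> J f @ U --> L f.
Proof.
move=> If; suff: cvg (J f @ U) by [].
have := @segment_compact R (- \int[P]_x `|f x|) (\int[P]_x `|f x|).
rewrite compact_ultra => /(_ (J f @ U) (ultra_fmap _ UU)).
case=> [|l [_ Jl]]; last by apply/cvg_ex; exists l.
by apply: (@filterE _ U) => s /=; rewrite in_itv/= -ler_norml Jnorm.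
Qed.

Let LE f l : J f @ U --> l -> L f = l.
Proof. exact: cvg_lim. Qed.

Let LD f g : Int f -> Int g -> L (f \+ g) = L f + L g.
Proof.
move=> If Ig; apply: LE.
rewrite (_ : J _ = J f \+ J g); first by apply: cvgD; exact: Jcvg.
apply/funext => s; rewrite /J/= -RintegralD//; [|exact: Jint..].
by apply: eq_Rintegral => x _; rewrite /= mulrDl.
Qed.

Let LZ c f : Int f -> L (c \*o f) = c * L f.
Proof.
move=> If; apply: LE.
rewrite (_ : J _ = c \*o J f); first by apply: cvgMr; exact: Jcvg.
apply/funext => s; rewrite /J/= -RintegralZl//; last exact: Jint.
by apply: eq_Rintegral => x _; rewrite /= mulrA.
Qed.

Let L0 : L (cst 0) = 0.
Proof.
have I0 : Int (cst 0) by exact: integrable0.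
rewrite -[RHS](mul0r (L (cst 0))) -LZ//; congr L.
by apply/funext => x /=; rewrite mul0r.
Qed.

(** This L^1 bound drives both the sigma-additivity of the limit and the passage from simple to
    integrable functions. *)
Let Lnorm f : Int f -> `|L f| <= \int[P]_x `|f x|.
Proof.
move=> If; have := Jcvg If; move/(cvg_norm) => JN.
rewrite -(cvg_lim _ JN)//; apply: limr_le; first by apply/cvg_ex; exists `|L f|.
by apply: nearW => s; exact: Jnorm.
Qed.

Let L_ge0 f : Int f -> (forall x, 0 <= f x) -> 0 <= L f.
Proof.
move=> If f0; apply: limr_ge; first exact/Jcvg.
apply: nearW => s; apply: Rintegral_ge0 => x _; rewrite mulr_ge0//.
by have [_ /(_ x)/andP[]] := hd s.
Qed.

Let I1 A : measurable A -> Int \1_A.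
Proof. by move=> mA; exact: integrable_indic. Qed.

Let int1 A : measurable A -> \int[P]_x (\1_A x : R) = fine (P A).
Proof. by move=> mA; rewrite /Rintegral integral_indic// setIT. Qed.

(** The default 0 keeps the set function nonnegative on nonmeasurable sets, where [L] has no
    controlled value. *)
Let m A : \bar R := if pselect (measurable A) is left _ then (L \1_A)%:E else
  0%E.

Let mE A : measurable A -> m A = (L \1_A)%:E.
Proof. by rewrite /m; case: pselect. Qed.

Let m0 : m set0 = 0%E.
Proof.
by rewrite mE// indic0 L0.
Qed.

Let m_ge0 A : (0 <= m A)%E.
Proof.
rewrite /m; case: pselect => // mA; rewrite lee_fin L_ge0//; first exact: I1.
Qed.

Let L_le f g : Int f -> Int g -> (forall x, f x <= g x) -> L f <= L g.
Proof.
move=> If Ig fg; have If' : Int ( -1 \*o f) := integrableZl measurableT (-1) If.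
rewrite -subr_ge0 -mulN1r -LZ// -LD//.
apply: L_ge0 => [|x /=]; last by rewrite mulN1r subr_ge0.
exact: (integrableD measurableT Ig If').
Qed.

Let m_sigma : semi_sigma_additive m.
Proof.
move=> F mF tF mUF; rewrite mE//.
pose p A := fine (P A).
pose SF n x : R := \sum_(0 <= i < n) \1_(F i) x.
have ISF n : Int (SF n).
  rewrite /Int (_ : EFin \o _ = fun x => (\sum_(0 <= i < n) (\1_(F i) x)%:E)%E).
    by apply: integrable_sum => // i _; exact: I1.
  by apply/funext => x /=; rewrite sumEFin.
have LSF n : L (SF n) = \sum_(0 <= i < n) L \1_(F i).
  elim: n => [|n IH].
    by rewrite big_nil -[RHS]L0; congr L; apply/funext => x;
      rewrite /SF big_nil.
  rewrite big_nat_recr//= -IH -LD//; last exact: I1.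
  by congr L; apply/funext => x; rewrite /SF big_nat_recr.
have SF1 n x : SF n x <= \1_(\bigcup_i F i) x.
  have [[k _ Fkx]|nF] := pselect ((\bigcup_i F i) x); last first.
    rewrite /SF big1// => i _; rewrite indicE memNset// => Fix.
    by apply: nF; exists i.
  have E i : i != k -> (\1_(F i) x : R) = 0.
    move=> ik; rewrite indicE memNset// => Fix.
    by move/trivIsetP : tF => /(_ i k I I ik); apply/eqP/set0P; exists x.
  rewrite [leRHS]indicE mem_set//=; last by exists k.
  rewrite /SF big_mkord; have [kn|nk] := ltnP k n.
    rewrite (bigD1 (Ordinal kn))//= big1 ?addr0.
      by rewrite indicE ler_nat leq_b1.
    by move=> i; rewrite -val_eqE => /E.
  by rewrite big1// => i _; rewrite E// neq_ltn (leq_trans (ltn_ord i)).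
have pSF n : \int[P]_x SF n x = \sum_(0 <= i < n) p (F i).
  elim: n => [|n IH].
    rewrite big_nil /Rintegral integral0_eq// => x _.
    by rewrite /SF big_nil.
  rewrite big_nat_recr//= -IH -[p _]int1// -RintegralD//;
    [|exact: ISF|exact: I1].
  by apply: eq_Rintegral => x _; rewrite /SF big_nat_recr.
have pcvg : (fun n => \sum_(0 <= i < n) p (F i)) @ \oo --> p (\bigcup_i F i).
  have : (fun n => \sum_(0 <= i < n) P (F i))%E @ \oo --> P (\bigcup_n F n).
    exact: measure_semi_sigma_additive.
  rewrite -(@fineK _ (P (\bigcup_n F n))) ?fin_num_measure// => /fine_cvg.
  apply: cvg_trans; apply: near_eq_cvg; apply: nearW => k /=.
  rewrite -[RHS]/(fine (\sum_(0 <= i < k) p (F i))%:E) -sumEFin; congr fine.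
  by apply: eq_bigr => i _; rewrite fineK// fin_num_measure.
have IU := I1 mUF.
suff key : (EFin \o (fun n => L (SF n))) @ \oo --> (L \1_(\bigcup_i F i))%:E.
  apply: (cvg_trans _ key); apply: near_eq_cvg; apply: nearW => n /=.
  by rewrite LSF -sumEFin; apply: eq_bigr => i _; exact/esym/mE.
apply: cvg_EFin; first exact: nearW.
(* By the L^1 bound, [L] of the indicator of the union differs from [L (SF n)] by at most the
   [P]-mass of the remaining sets, which tends to 0 by sigma-additivity of [P]. *)
apply: (@squeeze_cvgr _ _ _ _
  (fun n => L \1_(\bigcup_i F i) - (p (\bigcup_i F i) - \sum_(0 <= i < n) p (F
    i))) (cst (L \1_(\bigcup_i F i)))).
- apply: nearW => n; apply/andP; split; last exact: L_le.
  rewrite -[p _]int1// -pSF -RintegralB//; [|exact: ISF].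
  rewrite lerBlDr -[leLHS](_ : L (SF n) + L (\1_(\bigcup_i F i) \- SF n) = _);
    last first.
    rewrite -LD//; last exact: (integrableB measurableT IU (ISF n)).
    by congr L; apply/funext => x /=; rewrite addrC subrK.
  rewrite lerD2l (le_trans (ler_norm _))// (le_trans (Lnorm _))//.
    exact: (integrableB measurableT IU (ISF n)).
  rewrite le_eqVlt; apply/predU1P; left; apply: eq_Rintegral => x _ /=.
  by rewrite ger0_norm// subr_ge0.
- set u := (X in X @ _ --> _);
    have : u @ \oo --> L \1_(\bigcup_i F i) - (p (\bigcup_i F i) - p (\bigcup_i
    F i)).
    by apply: cvgB; [exact: cvg_cst|apply: cvgB; [exact: cvg_cst|exact: pcvg]].
  by rewrite subrr subr0.
- exact: cvg_cst.
Qed.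

(** The set function [m] is a measure dominated by [P], hence has a density [g]. The functionals [L]
    and integration against [g] agree on indicators, then on simple functions, then on integrable
    ones, because both are bounded by the L^1 norm. *)
Lemma weak_limit_linear : exists2 g, unit_density g &
  forall f, Int f -> J f @ U --> \int[P]_x (f x * g x).
Proof.
pose mm : {measure set T -> \bar R} :=
  HB.pack m (isMeasure.Build _ _ _ m m0 m_ge0 m_sigma).
have [|g gd gE] := @dominated_density _ _ _ P mm.
  move=> A mA; change (m A <= P A)%E;
    rewrite mE// -[P A]fineK ?fin_num_measure// lee_fin -int1//.
  apply: (le_trans (ler_norm _)); apply: (le_trans (Lnorm (I1 mA))).
  rewrite le_eqVlt; apply/predU1P; left; apply: eq_Rintegral => x _ /=.
  by rewrite ger0_norm.
exists g => // f intf.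
pose G f := \int[P]_x (f x * g x).
suff LG : L f = G f by have := Jcvg intf; rewrite LG.
have Gint f1 : Int f1 -> P.-integrable setT (EFin \o (f1 \* g)).
  by move=> ?; exact: (integrableM_density measurableT gd).
have G1 A : measurable A -> L \1_A = G \1_A.
  move=> mA; apply: EFin_inj; rewrite -mE// -[LHS]/(mm A) gE//.
  rewrite -[RHS]/((fine _)%:E) fineK; last first.
    by apply: integrable_fin_num => //; exact/Gint/I1.
  rewrite [LHS]integral_mkcond; apply: eq_integral => x _.
  by rewrite epatch_indic /= -EFinM mulrC.
have GZ c f1 : Int f1 -> G (c \*o f1) = c * G f1.
  move=> If; rewrite /G -RintegralZl//; last exact: Gint.
  by apply: eq_Rintegral => x _; rewrite /= mulrA.
have GD f1 f2 : Int f1 -> Int f2 -> G (f1 \+ f2) = G f1 + G f2.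
  move=> If Ig; rewrite /G -RintegralD//; [|exact: Gint..].
  by apply: eq_Rintegral => x _; rewrite /= mulrDl.
(* Integrability is proved in the same induction because additivity of [L] and [G] requires it. *)
have sumE (r : seq R) (A : R -> set T) : (forall y, measurable (A y)) ->
    Int (fun x => \sum_(y <- r) y * \1_(A y) x) /\
    L (fun x => \sum_(y <- r) y * \1_(A y) x) =
    G (fun x => \sum_(y <- r) y * \1_(A y) x).
  move=> mA; elim: r => [|y r [IH1 IH2]].
    rewrite (_ : (fun x => _) = (0 \*o \1_set0 : T -> R)); last first.
      by apply/funext => x; rewrite big_nil/= mul0r.
    have I10 := I1 measurable0.
    split; first exact: (integrableZl measurableT 0 I10).
    by rewrite LZ// GZ// G1.
  rewrite (_ : (fun x => _) = ((y \*o \1_(A y)) \+ (fun x => \sum_(y <- r) y *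
    \1_(A y) x))); last first.
    by apply/funext => x; rewrite big_cons.
  have I1y := integrableZl measurableT y (I1 (mA y)).
  split; first exact: (integrableD measurableT I1y IH1).
  by rewrite LD// GD// LZ ?I1// GZ ?I1// G1// IH2.
have [s_ [sint _ scvg]] := approximation_sfun_integrable measurableT intf.
have sE k : L (s_ k) = G (s_ k).
  rewrite (_ : (s_ k : T ->
    R) = fun x => \sum_(y <- finmap.enum_fset (fset_set (range (s_ k)))) y *
    \1_(s_ k @^-1` [set y]) x).
    by apply: (sumE _ (fun y => s_ k @^-1` [set y]) _).2 => y;
      exact: measurable_sfunP.
  by apply/funext => x; rewrite [LHS](fimfunE (s_ k)) fsbig_finite//=.
apply/eqP; rewrite -subr_eq0 -normr_le0; apply/ler_addgt0Pl => e e0;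
  rewrite addr0.
have e20 : 0 < e / 2 by rewrite divr_gt0.
have [k] : exists k, \int[P]_x `|f x - s_ k x| < e / 2.
  move/fine_cvgP : scvg => [_ /cvgrPdist_lt /(_ _ e20)[k _ /(_ k (leqnn k))]].
  rewrite /= sub0r normrN => ske; exists k; apply: le_lt_trans ske.
  by rewrite (le_trans _ (ler_norm _)).
have Is : Int (s_ k) := sint k.
have Isd : Int (f \- s_ k) := integrableB measurableT intf Is.
move=> ke; have -> : L f - G f = L (f \- s_ k) - G (f \- s_ k).
  have {1}-> : f = (f \- s_ k) \+ s_ k by apply/funext => x /=; rewrite subrK.
  have {2}-> : f = (f \- s_ k) \+ s_ k by apply/funext => x /=; rewrite subrK.
  by rewrite LD// GD// sE; ring.
rewrite (le_trans (ler_normB _ _))// [e]splitr lerD//.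
  by rewrite (le_trans (Lnorm Isd))// ltW.
by rewrite (le_trans (normr_int_density Isd gd))// ltW.
Qed.

End linear_limit.

(** The sum is 1 at every point and not merely almost everywhere, so that pointwise bounds such as
    [g i x + g j x <= 1] can be used. *)
Definition density_family n (g : 'I_n -> T -> R) :=
  (forall i, unit_density (g i)) /\ forall x, \sum_i g i x = 1.

Lemma unit_density_weak_limit S (U : set_system S) (h : S -> T -> R) :
  UltraFilter U -> (\forall s \near U, unit_density (h s)) ->
  exists2 g, unit_density g & forall f, P.-integrable setT (EFin \o f) ->
    \int[P]_x (f x * h s x) @[s --> U] --> \int[P]_x (f x * g x).
Proof.
move=> UU Uh; pose h' s :=
  if pselect (unit_density (h s)) is left _ then h s else cst 0.
have h'd s : unit_density (h' s).
  by rewrite /h'; case: pselect => // _; split=> // x; rewrite lexx ler01.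
have [g gd gE] := weak_limit_linear UU h'd; exists g => // f /gE.
apply: cvg_trans; apply: near_eq_cvg; near=> s.
rewrite /h'; case: pselect => // -[].
by near: s.
Unshelve. all: by end_near. Qed.

Lemma Rintegral_sumM_density n f (g : 'I_n -> T -> R) :
  P.-integrable setT (EFin \o f) -> (forall i, unit_density (g i)) ->
  \int[P]_x (f x * \sum_i g i x) = \sum_i \int[P]_x (f x * g i x).
Proof.
move=> intf gd; have intfg i := integrableM_density measurableT (gd i) intf.
apply: EFin_inj; rewrite -sumEFin /Rintegral fineK.
  under eq_integral do rewrite mulr_sumr -sumEFin.
  rewrite integral_sum//; apply: eq_bigr => i _; rewrite fineK//.
  by apply: integrable_fin_num => //; exact: intfg.
apply: integrable_fin_num => //.
rewrite (_ : (fun x => _) = fun x => (\sum_i (f x * g i x)%:E)%E).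
  by apply: integrable_sum => // i _; exact: intfg.
by apply/funext => x; rewrite mulr_sumr -sumEFin.
Qed.

(** The hypothesis on integrals says that the sum is 1 almost everywhere; on the exceptional null
    set the [g i] are replaced by a given exact family [h0]. *)
Lemma density_family_correction n (g h0 : 'I_n -> T -> R) :
  (forall i, unit_density (g i)) -> density_family h0 ->
  (forall A, measurable A ->
    (\sum_i \int[P]_(x in A) (g i x)%:E)%E = P A) ->
  exists2 g', density_family g' &
    forall i, ae_eq P setT (EFin \o g' i) (EFin \o g i).
Proof.
move=> gd [h0d h01] gP.
have mg i : measurable_fun setT (g i) by have [] := gd i.
have ig i : P.-integrable setT (EFin \o g i) by apply: bdd_density_integrable;
  exact: gd.
pose G x := \sum_i g i x.
have mG : measurable_fun setT G by exact: measurable_sum.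
pose D := [set x | G x = 1].
have mD : measurable D.
  by rewrite /D -[X in measurable X]setTI;
    exact: (mG measurableT [set 1] (measurable_set1 1)).
have GE : EFin \o G = fun x => (\sum_i (g i x)%:E)%E.
  by apply/funext => x; rewrite /= sumEFin.
have GP : ae_eq P setT (EFin \o G) (cst 1%E).
  apply: integral_ae_eq => //; first by rewrite GE;
    apply: integrable_sum => // i _; exact: ig.
  move=> A _ mA; transitivity (P A); last by rewrite integral_cst// mul1e.
  rewrite -gP// GE integral_sum// => i.
  exact: integrableS (ig i).
pose g' i x := g i x * \1_D x + h0 i x * \1_(~` D) x.
exists g'; first split=> [i|x].
- have [_ g01] := gd i; have [mh h001] := h0d i; split.
    apply: measurable_funD; apply: measurable_funM => //.
    exact/measurable_indic/measurableC.
  move=> x; rewrite /g' !indicE in_setC; case: (x \in D).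
    by rewrite /= mulr1 mulr0 addr0 g01.
  by rewrite /= mulr1 mulr0 add0r h001.
- rewrite /g'; have [xD|xD] := pselect (D x).
    rewrite -[RHS]xD; apply: eq_bigr => i _.
    by rewrite !indicE in_setC mem_set//= mulr1 mulr0 addr0.
  rewrite -[RHS](h01 x); apply: eq_bigr => i _.
  by rewrite !indicE in_setC memNset//= mulr1 mulr0 add0r.
move=> i; apply: filterS GP => x /(_ Logic.I) [Gx] _ /=.
by rewrite /g' !indicE in_setC mem_set//= mulr1 mulr0 addr0.
Qed.

Lemma eq_ae_Rintegral_density (g g' f : T -> R) :
  unit_density g -> unit_density g' -> P.-integrable setT (EFin \o f) ->
  ae_eq P setT (EFin \o g) (EFin \o g') ->
  \int[P]_x (f x * g x) = \int[P]_x (f x * g' x).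
Proof.
move=> [mg _] [mg' _] intf gg'.
have mf : measurable_fun setT f by exact/measurable_EFinP/(measurable_int P).
congr fine; apply: ae_eq_integral => //.
- by apply/measurable_EFinP/measurable_funM.
- by apply/measurable_EFinP/measurable_funM.
by apply: filterS gg' => x /(_ Logic.I) [->].
Qed.

Lemma integral_density_indic (g : T -> R) A : unit_density g -> measurable A ->
  (\int[P]_(x in A) (g x)%:E = (\int[P]_x (\1_A x * g x))%:E)%E.
Proof.
move=> gd mA; rewrite -[LHS]fineK; last first.
  apply: integrable_fin_num => //.
  by apply: integrableS (bdd_density_integrable P gd).
rewrite -/(Rintegral P A g) Rintegral_mkcond patch_indic.
by congr EFin; apply: eq_Rintegral => x _; rewrite mulrC.
Qed.

(** Limits are taken coordinate by coordinate. Testing their sum against indicators shows that it is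
    1 almost everywhere, and the correction makes it exact. *)
Lemma density_family_weak_limit n (U : set_system ('I_n -> T -> R)) :
  UltraFilter U -> U (@density_family n) ->
  exists2 g, density_family g & forall f i, P.-integrable setT (EFin \o f) ->
    \int[P]_x (f x * h i x) @[h --> U] --> \int[P]_x (f x * g i x).
Proof.
move=> UU Ud.
have /choice[g gP] (i : 'I_n) : exists g, unit_density g /\
    forall f, P.-integrable setT (EFin \o f) ->
    \int[P]_x (f x * h i x) @[h --> U] --> \int[P]_x (f x * g x).
  have [|g gd gE] := @unit_density_weak_limit _ U (fun h => h i) UU.
    by apply: filterS Ud => h [].
  by exists g.
(* A set of the ultrafilter is nonempty, which supplies the exact family needed for the
   correction. *)
have [h0 h0d] := filter_ex Ud.
have gd i : unit_density (g i) by have [] := gP i.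
have [A mA|g' g'd g'E] := density_family_correction gd h0d.
  have intA : P.-integrable setT (EFin \o (\1_A : T ->
    R)) by exact: integrable_indic.
  under eq_bigr do rewrite integral_density_indic//.
  rewrite sumEFin -[RHS]fineK ?fin_num_measure//; congr EFin.
  have lim1 : \sum_i \int[P]_x (\1_A x * h i x) @[h --> U] -->
      \sum_i \int[P]_x (\1_A x * g i x).
    by apply: cvg_sum_ord => i; have [_] := gP i; exact.
  rewrite -(cvg_lim _ lim1)//; apply: cvg_lim => //.
  apply: cvg_near_cst; apply: filterS Ud => h [hd h1].
  rewrite -Rintegral_sumM_density// -[A in RHS]setIT -integral_indic//.
  by apply: eq_Rintegral => x _; rewrite h1 mulr1.
exists g' => // f i intf; have [_ /(_ f intf)] := gP i.
rewrite (@eq_ae_Rintegral_density _ (g i) f _ _ intf (g'E i))//.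
by have [] := g'd.
Qed.

End weak_limit.

Lemma cvg_rV (R : realType) S (F : set_system S) {FF : Filter F} n
    (f : S -> 'rV[R]_n) (l : 'rV[R]_n) :
  (forall i, f s 0 i @[s --> F] --> l 0 i) -> f @ F --> l.
Proof.
move=> fl; apply/cvg_ballP => e e0.
have : \forall s \near F, forall i : 'I_n, ball (l 0 i) e (f s 0 i).
  by apply: filter_forall => i; move/cvg_ballP : (fl i) => /(_ e e0).
by apply: filterS => s h; split=> // i j; rewrite !ord1.
Qed.

(** * Compactness of images of weakly closed sets of families *)

Section weak_compactness.
Context d (T : measurableType d) (R : realType)
  (P : {finite_measure set T -> \bar R}).

(** The test functions are all integrable ones, possibly unbounded, since the constraints and the
    values involve the identity and [f]. *)
Definition weak_limit n (U : set_system ('I_n -> T -> R)) (g : 'I_n -> T ->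
  R) :=
  forall f i, P.-integrable setT (EFin \o f) ->
    \int[P]_x (f x * h i x) @[h --> U] --> \int[P]_x (f x * g i x).

(** No topology is put on families: an ultrafilter on the image is lifted through a choice of
    preimages, the lift has a weak limit, and the hypothesis sends this limit back to a limit in the
    image. *)
Lemma weak_compact_image n (A : set ('I_n -> T -> R)) (V : topologicalType)
    (Phi : ('I_n -> T -> R) -> V) : A `<=` @density_family _ _ _ n ->
  (forall U g, UltraFilter U -> U A -> density_family g -> weak_limit U g ->
    A g /\ Phi @ U --> Phi g) ->
  compact (Phi @` A).
Proof.
move=> Ad lim; rewrite compact_ultra => F FU FA.
(* [s] selects preimages under [Phi]; the zero family is a default off the image. *)
have /choice[s sP] (v : V) : exists g, (Phi @` A) v -> A g /\ Phi g = v.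
  have [[g Ag gv]|nv] := pselect ((Phi @` A) v); first by exists g.
  by exists (fun _ _ => 0).
have sU := ultra_fmap s FU.
have FsA : F (s @^-1` A) by apply: filterS FA => v /sP[].
have sA : (s @ F) A by exact: FsA.
have [g gd gl] := density_family_weak_limit P sU (filterS Ad sA).
have [Ag Phig] := lim _ _ sU sA gd gl.
exists (Phi g); split; first by exists g.
apply: cvg_trans Phig => W /= sW.
have sW' : F (fun v => W (Phi (s v))) by exact: sW.
by apply: filterS (filterI FA sW') => v [/sP[_ {2}<-]].
Qed.

End weak_compactness.

(** * Transports from a finitely supported measure *)

Section marginals.
Context d d' (T : measurableType d) (T' : measurableType d') (R : realType).
Variables (mu : {finite_measure set T -> \bar R})
  (P : {finite_measure set T' -> \bar R}) (phi : T -> T').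
Hypotheses (mphi : measurable_fun setT phi)
  (phiP : forall B, measurable B -> mu (phi @^-1` B) = P B).

Lemma integrable_marginal (f : T' -> R) : P.-integrable setT (EFin \o f) ->
  mu.-integrable setT (EFin \o (f \o phi)).
Proof.
move=> intf; have mf := measurable_int _ intf.
apply/integrableP; split.
  by apply/measurable_EFinP; apply: measurableT_comp => //;
    exact/measurable_EFinP.
have mf' : measurable_fun setT (abse \o EFin \o f) by apply: (measurableT_comp _
  mf).
have := @ge0_integral_pushforward _ _ _ _ _ _ mphi mu setT (abse \o EFin \o f)
  measurableT mf' (fun _ _ => abse_ge0 _).
rewrite preimage_setT => <-.
case/integrableP : intf => _; apply: le_lt_trans.
rewrite le_eqVlt; apply/predU1P; left; apply: eq_measure_integral => B mB _.
exact: phiP.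
Qed.

(** Two densities meet in one measure: the restriction of [mu] to [D] has density [\1_D] for [mu],
    and its image under [phi] has density [g] for [P]. *)
Lemma integral_marginal_density (D : set T) (g f : T' -> R) :
  measurable D -> unit_density g ->
  (forall B, measurable B ->
    mu (D `&` phi @^-1` B) = \int[P]_(y in B) (g y)%:E)%E ->
  P.-integrable setT (EFin \o f) ->
  (\int[mu]_(w in D) (f (phi w))%:E = \int[P]_y (f y * g y)%:E)%E.
Proof.
move=> mD gd Dg intf; have intfphi := integrable_marginal intf.
have mf : measurable_fun setT (EFin \o f) := measurable_int _ intf.
have D1 : unit_density (\1_D : T -> R).
  by split=> [|x]; [exact: measurable_indic|rewrite indicE ler0n lern1 leq_b1].
pose m := mrestr mu mD.
have [|intm mE] := @integral_density _ _ _ mu m 1 _ D1 _ _ _ measurableT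
  intfphi.
  move=> A mA; rewrite integral_indic// setIC//.
have := @integral_pushforward _ _ _ _ _ _ mphi m setT _ mf intm measurableT.
rewrite preimage_setT /= mE => fE.
have [pm pmE] : exists pm : {measure set T' -> \bar R}, forall B,
  pm B = m (phi @^-1` B).
  by unshelve eexists (pushforward m phi : {measure set T' -> \bar R}).
have [|_ fgE] := @integral_density _ _ _ P pm 1 _ gd _ _ _ measurableT intf.
  by move=> B mB; rewrite pmE -Dg// setIC.
rewrite -fgE (@eq_measure_integral _ _ _ _ (pushforward m phi)) => [|B mB _];
  last exact: pmE.
rewrite fE integral_mkcond; apply: eq_integral => x _.
by rewrite epatch_indic.
Qed.

End marginals.

Section atoms.
Context {R : realType} d (T : measurableType d) n (a : 'I_n -> R).
Local Notation RR := (measurableTypeR R).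
Variables (mu : {finite_measure set T -> \bar R}) (phi : T -> RR).
Hypotheses (a_inj : injective a) (mphi : measurable_fun setT phi)
  (phi_full : mu (phi @^-1` (~` range a)) = 0%E).

Lemma measurable_finite_range : measurable (range a : set RR).
Proof.
rewrite (_ : range a = \bigcup_(i in [set: 'I_n]) [set a i]).
  by apply: fin_bigcup_measurable => // i _; exact: measurable_set1.
by apply/seteqP; split=> [_ [i _ <-]|_ [i _ ->]]; exists i.
Qed.

(** The fibres of [phi] over the [a i] are disjoint by injectivity and cover everything up to a null
    set. *)
Lemma integral_atoms (A : set T) (f : T -> R) : measurable A ->
  mu.-integrable A (EFin \o f) ->
  (\int[mu]_(w in A) (f w)%:E =
   \sum_i \int[mu]_(w in phi @^-1` [set a i] `&` A) (f w)%:E)%E.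
Proof.
move=> mA intf; pose N := phi @^-1` (~` range a).
have mN : measurable N.
  rewrite -[N]setTI; apply: mphi => //.
  by apply: measurableC; exact: measurable_finite_range.
have mphi1 i : measurable (phi @^-1` [set a i]).
  by rewrite -[X in measurable X]setTI; apply: mphi => //;
    exact: measurable_set1.
rewrite (negligible_integral mN mA intf phi_full).
have AE : A `\` N = \big[setU/set0]_(i < n) (phi @^-1` [set a i] `&` A).
  rewrite -bigcup_seq; apply/seteqP; split=> [x [Ax]|x [i _ [xi Ax]]].
    rewrite /N/= => /contrapT[i _ aix]; exists i => //=.
    by rewrite mem_index_enum.
  by split=> //; apply; exists i.
rewrite AE integral_bigsetU_EFin//.
- by move=> i; exact: measurableI.
- exact: index_enum_uniq.
- apply/trivIsetP => i j _ _ ij; apply/seteqP;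
    split=> // x [[/= -> _] [/a_inj ji _]].
  by rewrite ji eqxx in ij.
- rewrite -AE; apply: measurable_funS (measurable_int _ intf) => //.
Qed.

Lemma measure_atoms (A : set T) : measurable A ->
  (mu A = \sum_i mu (phi @^-1` [set a i] `&` A))%E.
Proof.
move=> mA; have int1 B : measurable B ->
  (\int[mu]_(w in B) (cst 1 w : R)%:E)%E = mu B.
  by move=> mB; rewrite -[RHS]mul1e -(integral_cst mu mB).
rewrite -int1// integral_atoms//; last exact: finite_measure_integrable_cst.
apply: eq_bigr => i _; rewrite int1//; apply: measurableI => //.
by rewrite -[X in measurable X]setTI; apply: mphi => //; exact: measurable_set1.
Qed.

End atoms.

(** * Martingale transports as families of densities *)

Section transport_density.
Context {R : realType}.
Local Notation RR := (measurableTypeR R).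
Variables (lambda1 lambda2 : probability RR R) (n : nat) (a : 'I_n -> R).
Hypotheses (a_inj : injective a) (a_full : lambda1 (~` range a) = 0%E).
Implicit Types (nu : probability (RR * RR)%type R) (g : 'I_n -> R -> R).

Let strip i : set (RR * RR)%type := fst @^-1` [set a i].

Definition atom_mass (i : 'I_n) : R := fine (lambda1 [set a i]).

Definition coupling_density nu g := forall i B, measurable B ->
  (nu (strip i `&` snd @^-1` B) = \int[lambda2]_(y in B) (g i y)%:E)%E.

(* The densities with respect to [lambda2] of the restrictions
   [nu ({a_i} * .)] of a martingale transport. *)
Definition transport_family g :=
  [/\ density_family (T := RR) g,
      forall i, \int[lambda2]_y (1 * g i y) = atom_mass i &
      forall i, \int[lambda2]_y (y * g i y) = atom_mass i * a i].

Hypothesis mean2 : lambda2.-integrable setT (EFin \o (id : R -> R)).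

Let mfst B : measurable B -> measurable (fst @^-1` B : set (RR * RR)%type).
Proof. by move=> mB; rewrite -[X in measurable X]setTI;
  exact: measurable_fst. Qed.

Let msnd B : measurable B -> measurable (snd @^-1` B : set (RR * RR)%type).
Proof. by move=> mB; rewrite -[X in measurable X]setTI;
  exact: measurable_snd. Qed.

Let mstrip i : measurable (strip i).
Proof. exact: mfst. Qed.

Let marrange : measurable (range a : set RR).
Proof. exact: measurable_finite_range. Qed.

Let nu_full nu : (forall B, measurable B -> nu (fst @^-1` B) = lambda1 B) ->
  nu (fst @^-1` (~` range a)) = 0%E.
Proof. by move=> nu1; rewrite nu1//; exact: measurableC. Qed.

Let coupling_density_fst nu g i : (forall B,
  measurable B -> nu (fst @^-1` B) = lambda1 B) ->
  coupling_density nu g -> unit_density (g i) ->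
  \int[lambda2]_y (1 * g i y) = atom_mass i.
Proof.
move=> nu1 nug gd; rewrite /atom_mass -nu1// -[fst @^-1` _]setIT.
rewrite -(preimage_setT snd) nug//; congr fine.
by apply: eq_integral => y _; rewrite mul1r.
Qed.

Lemma integral_strip_snd nu g i f :
  (forall B, measurable B -> nu (snd @^-1` B) = lambda2 B) ->
  coupling_density nu g -> unit_density (g i) ->
  lambda2.-integrable setT (EFin \o f) ->
  (\int[nu]_(w in strip i) (f w.2)%:E = \int[lambda2]_y (f y * g i y)%:E)%E.
Proof.
move=> nu2 nug gd intf.
by apply: (@integral_marginal_density _ _ _ _ _ nu lambda2 snd) => // B mB;
  exact: nug.
Qed.

(** The part of [nu] over [a i] is dominated by the second marginal, hence has a density bounded by
    1. The masses come from the first marginal and the barycentres from the martingale property. *)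
Lemma transport_has_density nu : martingale_transport lambda1 lambda2 nu ->
  exists2 g, transport_family g & coupling_density nu g.
Proof.
move=> [nu1 nu2 [Z [int2 intZ _ ZE] Z1]].
have /choice[g gP] (i : 'I_n) : exists h : RR -> R, unit_density h /\
    forall B, measurable B ->
      (nu (strip i `&` snd @^-1` B) = \int[lambda2]_(y in B) (h y)%:E)%E.
  have [pm pmE] : exists pm : {measure set RR -> \bar R}, forall B,
    pm B = nu (strip i `&` snd @^-1` B).
    unshelve eexists (pushforward (mrestr nu (mstrip i)) (snd : RR * RR ->
      RR) : {measure set RR -> \bar R}).
    + exact: measurable_snd.
    + by move=> B; rewrite setIC.
  have [|h hd hE] := @dominated_density _ _ _ lambda2 pm.
    move=> B mB; rewrite pmE; apply: (@le_trans _ _ (nu (snd @^-1` B))).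
      rewrite le_measure ?inE//; last exact: msnd.
      by apply: measurableI => //; exact: msnd.
    by rewrite nu2.
  by exists h; split=> // B mB; rewrite -pmE hE.
have gd i : unit_density (g i) by have [] := gP i.
have gsum A : measurable A ->
  (\sum_i \int[lambda2]_(x in A) (g i x)%:E)%E = lambda2 A.
  move=> mA; rewrite -nu2//
    (measure_atoms a_inj measurable_fst (nu_full nu1))//.
    by apply: eq_bigr => i _; have [_ giE] := gP i; exact/esym/giE.
  exact: msnd.
(* An empty index set would give [lambda2] total mass 0. The index obtained carries the default
   family [h0], concentrated on one strip. *)
have n0 : (0 < n)%N.
  rewrite lt0n; apply/eqP => n0; have := gsum setT measurableT.
  rewrite probability_setT big1 => [/eqP|i _]; last by have := ltn_ord i;
    rewrite [X in (_ < X)%N]n0.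
  by rewrite eq_sym onee_eq0.
pose i0 := Ordinal n0.
pose h0 (i : 'I_n) (_ : RR) : R := (i == i0)%:R.
have h0d : density_family h0.
  split=> [i|x]; last first.
    by rewrite (bigD1 i0)//= big1 ?addr0 /h0 ?eqxx// => i /negPf ->.
  split=> [|x]; first exact: measurable_cst.
  by rewrite /h0 ler0n lern1 leq_b1.
have [g' g'd g'g] := density_family_correction gd h0d gsum.
have nug' : coupling_density nu g'.
  move=> i B mB; have [_ ->//] := gP i; apply: ae_eq_integral => //.
  - by apply/measurable_EFinP/measurable_funTS; have [] := gd i.
  - by apply/measurable_EFinP/measurable_funTS; have [+ _] := g'd; case/(_ i).
  - by apply: filterS (g'g i) => x /(_ Logic.I) /= ->.
have [g'i _] := g'd.
exists g' => //; split=> // i;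
  first exact: (coupling_density_fst nu1 nug' (g'i i)).
rewrite /Rintegral -(integral_strip_snd nu2 nug' (g'i i) mean2).
transitivity (fine (\int[nu]_(w in strip i) (cst (a i)%:E w)))%E; last first.
  rewrite integral_cst//.
  transitivity (fine ((a i)%:E * lambda1 [set a i]))%E.
    by congr (fine (_ * _))%E; exact: nu1.
  by rewrite fineM ?fin_num_measure// mulrC.
(* The conditional expectation is tested on the event [X_1 = a i], where its version [Z] is almost
   surely [a i]. *)
congr fine; transitivity (\int[nu]_(w in strip i) (Z w)%:E)%E.
  by rewrite ZE//; exists [set a i] => //; rewrite setTI.
apply: ae_eq_integral => //.
- exact: measurable_funTS (measurable_int _ intZ).
- have ZF : Filter (almost_everywhere nu) by exact: ae_filter_ringOfSetsType.
  by apply: filterS Z1 => w /= -> ->.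
Qed.

Hypothesis mean1 : lambda1.-integrable setT (EFin \o (id : R -> R)).

Let lambda1_atoms B : measurable B ->
  lambda1 B = (\sum_i (if a i \in B then lambda1 [set a i] else 0))%E.
Proof.
move=> mB; rewrite (measure_atoms (phi := id) a_inj)//.
apply: eq_bigr => i _; case: ifPn => [/set_mem aiB|/negP aiB].
  by congr (lambda1 _); apply/seteqP; split=> [x []//|x /= ->].
rewrite -[RHS](measure0 lambda1); congr (lambda1 _).
by apply/seteqP; split=> // x [/= -> /mem_set].
Qed.

(** The measure is the sum over [i] of the products of the Dirac mass at [a i] with [g i] times
    [lambda2], given through sections. *)
Let density_measure g : density_family (T := RR) g ->
  exists m : {measure set (RR * RR)%type -> \bar R},
    forall A, m A = (\sum_i \int[lambda2]_(y in pair (a i) @^-1` A) (g i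
      y)%:E)%E.
Proof.
move=> [gd _].
pose m (A : set (RR * RR)%type) : \bar R :=
  (\sum_i \int[lambda2]_(y in pair (a i) @^-1` A) (g i y)%:E)%E.
have g0 i y : (0 <= (g i y)%:E)%E by have [_ /(_ y)/andP[]] := gd i;
  rewrite lee_fin.
have m0 : m set0 = 0%E.
  by rewrite /m big1// => i _; rewrite preimage_set0 integral_set0.
have m_ge0 A : (0 <= m A)%E.
  by apply: sume_ge0 => i _; apply: integral_ge0.
have msigma : semi_sigma_additive m.
  move=> F mF tF mUF.
  rewrite [X in X @ _ --> _](_ : _ = fun k => (\sum_(i < n) \sum_(0 <= j < k)
      \int[lambda2]_(y in pair (a i) @^-1` F j) (g i y)%:E)%E); last first.
    by apply/funext => k; rewrite exchange_big.
  apply: cvg_nnesum => i _.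
    by apply: nearW => k; apply: sume_ge0 => j _; exact: integral_ge0.
  have mpair A : measurable A -> measurable (pair (a i) @^-1` A : set RR).
    by move=> mA; rewrite -[X in measurable X]setTI; exact: pair1_measurable.
  have mg : measurable_fun setT (EFin \o g i).
    by apply/measurable_EFinP; have [] := gd i.
  have tpair : trivIset setT (fun j => pair (a i) @^-1` F j).
    apply/trivIsetP => j k _ _ jk; rewrite -preimage_setI.
    by move/trivIsetP : tF => /(_ j k Logic.I Logic.I jk) ->;
      rewrite preimage_set0.
  have := @semi_sigma_additive_nng_induced _ _ _ lambda2 _ mg (g0 i) _ (fun j =>
    mpair _ (mF j)) tpair.
  by rewrite preimage_bigcup; apply; rewrite -preimage_bigcup; exact: mpair.
pose mm : {measure set (RR * RR)%type -> \bar R} :=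
  HB.pack m (isMeasure.Build _ _ _ m m0 m_ge0 msigma).
by exists mm.
Qed.

(** Fixed masses give the first marginal and the partition of unity gives the second. The martingale
    identity only has to be checked on strips, where it is the barycentre condition. *)
Lemma density_has_transport g : transport_family g ->
  exists nu : probability (RR * RR)%type R,
    [/\ martingale_transport lambda1 lambda2 nu, coupling_density nu g &
      forall A, measurable A ->
        (nu A = \sum_i \int[lambda2]_(y in pair (a i) @^-1` A) (g i y)%:E)%E].
Proof.
move=> [gd gp gm]; have [m mE] := density_measure gd; have [gd1 gsum] := gd.
have gint i : (\int[lambda2]_(y in setT) (g i y)%:E = lambda1 [set a i])%E.
  rewrite -[LHS]fineK; last first.
    by apply: integrable_fin_num => //; apply: bdd_density_integrable;
      exact: gd1.
  rewrite -[RHS]fineK ?fin_num_measure//; congr EFin.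
  by rewrite -[RHS]gp; apply: eq_Rintegral => y _; rewrite mul1r.
have m1 B : measurable B -> m (fst @^-1` B) = lambda1 B.
  move=> mB; rewrite mE lambda1_atoms//; apply: eq_bigr => i _.
  rewrite -gint -comp_preimage/=; case: ifPn => [/set_mem|/negP] aiB.
    by congr integral; apply/seteqP; split=> // y _.
  rewrite (_ : _ @^-1` B = set0) ?integral_set0//.
  by apply/seteqP; split=> // y /= /mem_set.
have m2 B : measurable B -> m (snd @^-1` B) = lambda2 B.
  move=> mB; rewrite mE -[RHS]mul1e -(integral_cst lambda2 mB).
  transitivity (\sum_i \int[lambda2]_(y in B) (g i y)%:E)%E; first by [].
  rewrite -integral_sum//=.
    by apply: eq_integral => y _; rewrite sumEFin gsum.
  by move=> i; apply: integrableS (bdd_density_integrable lambda2 (gd1 i)).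
have mT : m setT = 1%E by rewrite -(preimage_setT fst) m1// probability_setT.
(* The total mass is 1, so normalization changes no value and the Dirac measure is never
   selected. *)
pose nu : probability (RR * RR)%type R :=
  mnormalize m (\d_ (point : (RR * RR)%type)).
have numE A : nu A = m A by rewrite /nu/= /mnormalize/= mT onee_eq0/= invr1
  mule1.
have nu1 B : measurable B -> nu (fst @^-1` B) = lambda1 B by rewrite numE;
  exact: m1.
have nu2 B : measurable B -> nu (snd @^-1` B) = lambda2 B by rewrite numE;
  exact: m2.
have nuE A : nu A = (\sum_i \int[lambda2]_(y in pair (a i) @^-1` A) (g i
  y)%:E)%E.
  by rewrite numE.
have nug : coupling_density nu g.
  move=> i B mB; rewrite nuE (bigD1 i)//= big1 ?adde0.
    by congr (integral _ _ _); apply/seteqP; split=> [y []//|y ?]; split.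
  move=> j ji; rewrite (_ : _ @^-1` _ = set0) ?integral_set0//.
  by apply/seteqP; split=> // y [/a_inj ij]; rewrite ij eqxx in ji.
have int1 : nu.-integrable setT (EFin \o fst).
  exact: (@integrable_marginal _ _ _ _ _ nu lambda1 fst measurable_fst nu1 id
    mean1).
have int2 : nu.-integrable setT (EFin \o snd).
  exact: (@integrable_marginal _ _ _ _ _ nu lambda2 snd measurable_snd nu2 id
    mean2).
exists nu; split=> //; split=> //; exists fst; last exact: aeW.
split=> // [B mB|A [B mB]]; first by exists B => //; rewrite setTI.
rewrite setTI => <-{A}; have mA := mfst mB.
(* Up to a null set, an event depending on the first coordinate only is the union of the strips over
   the atoms in [B]. *)
have intA (f : R * R -> R) : nu.-integrable setT (EFin \o f) ->
    (\int[nu]_(w in fst @^-1` B) (f w)%:E =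
     \sum_i (if a i \in B then \int[nu]_(w in strip i) (f w)%:E else 0))%E.
  move=> intf; rewrite (integral_atoms a_inj measurable_fst (nu_full nu1))//;
    last first.
    exact: integrableS intf.
  apply: eq_bigr => i _; case: ifPn => [/set_mem|/negP] aiB.
    by congr (integral _ _ _); apply/seteqP; split=> [w []//|w /= wi];
      split=> //=; rewrite wi.
  rewrite (_ : _ `&` _ = set0) ?integral_set0//.
  by apply/seteqP; split=> // w [/= -> /mem_set].
rewrite !intA//; apply: eq_bigr => i _; case: ifP => // _.
rewrite [RHS](integral_strip_snd nu2 nug (gd1 i) mean2).
rewrite -[RHS]fineK; last first.
  by apply: integrable_fin_num => //;
    exact: (integrableM_density measurableT (gd1 i) mean2).
rewrite -[fine _]/(\int[lambda2]_y (y * g i y)) gm.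
transitivity (\int[nu]_(w in strip i) (cst (a i)%:E w))%E.
  by apply: eq_integral => w /set_mem /= ->.
rewrite integral_cst//; transitivity ((a i)%:E * lambda1 [set a i])%E.
  by congr (_ * _)%E; exact: nu1.
by rewrite /atom_mass EFinM fineK ?fin_num_measure// muleC.
Qed.

(** The conditional law has density [g i] divided by the mass of the atom. *)
Lemma integral_cond_law nu g i (f : R -> R) :
  (forall B, measurable B -> nu (fst @^-1` B) = lambda1 B) ->
  coupling_density nu g -> unit_density (g i) ->
  lambda2.-integrable setT (EFin \o f) ->
  (cond_law nu (a i)).-integrable setT (EFin \o f) /\
  \int[cond_law nu (a i)]_x f x =
    (atom_mass i)^-1 * \int[lambda2]_x (f x * g i x).
Proof.
move=> nu1 nug gd intf; have [mg g01] := gd.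
have p0 : 0 <= (atom_mass i)^-1 by rewrite invr_ge0 fine_ge0.
have hd : bdd_density (atom_mass i)^-1 (fun x => (atom_mass i)^-1 * g i x).
  split=> [|x]; first exact: measurable_funM.
  by have /andP[g0 g1] := g01 x; rewrite mulr_ge0//= ler_piMr.
have [B mB|intc cE] := integral_density (P := lambda2) (m :=
  cond_law nu (a i)) hd _ measurableT intf.
  transitivity ((atom_mass i)^-1%:E * \int[lambda2]_(y in B) (g i y)%:E)%E.
    by rewrite -nug// /atom_mass -nu1.
  rewrite -integralZl//.
  by apply: integrableS (bdd_density_integrable lambda2 gd).
split=> //; rewrite /Rintegral cE -[RHS]RintegralZl//.
  by apply: eq_Rintegral => x _; rewrite mulrCA.
exact: (@integrableM_density _ RR _ lambda2 setT f _ _ measurableT gd intf).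
Qed.

End transport_density.

(** * Concave functions and exchange of mass *)

Section chords.
Context {R : realType}.
Implicit Types (E : set R) (phi : R -> R).

(* The three-point form of concavity, free of divisions. *)
Definition concave3 E phi :=
  forall x y z, E x -> E y -> E z -> x < y -> y < z ->
  phi x * (z - y) + phi z * (y - x) <= phi y * (z - x).

Definition strictly_concave3 E phi :=
  forall x y z, E x -> E y -> E z -> x < y -> y < z ->
  phi x * (z - y) + phi z * (y - x) < phi y * (z - x).

Lemma strictly_concave3W E phi : strictly_concave3 E phi -> concave3 E phi.
Proof. by move=> h x y z *; apply/ltW/h. Qed.

Definition chord phi s t x := phi s + (phi t - phi s) / (t - s) * (x - s).

Lemma chord_outside E phi s t x : concave3 E phi -> E s -> E t -> s < t ->
  E x ->
  ~~ (s < x < t) -> phi x <= chord phi s t x.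
Proof.
move=> cphi Es Et st Ex; have ts0 : 0 < t - s by rewrite subr_gt0.
rewrite /chord -(ler_pM2r ts0) mulrDl mulrAC divfK ?gt_eqF//.
rewrite negb_and -!leNgt le_eqVlt => /orP[/predU1P[->|xs]|].
- by rewrite subrr mulr0 addr0.
- by have := cphi x s t Ex Es Et xs st; lra.
rewrite le_eqVlt => /predU1P[<-|tx]; first lra.
by have := cphi s t x Es Et Ex st tx; lra.
Qed.

Lemma chord_inside E phi s t x : concave3 E phi -> E s -> E t -> E x ->
  s < x < t -> chord phi s t x <= phi x.
Proof.
move=> cphi Es Et Ex /andP[sx xt].
have ts0 : 0 < t - s by rewrite subr_gt0 (lt_trans sx).
rewrite /chord -(ler_pM2r ts0) mulrDl mulrAC divfK ?gt_eqF//.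
by have := cphi s x t Es Ex Et sx xt; lra.
Qed.

Lemma chord_inside_lt E phi s t x : strictly_concave3 E phi -> E s -> E t ->
  E x ->
  s < x < t -> chord phi s t x < phi x.
Proof.
move=> cphi Es Et Ex /andP[sx xt].
have ts0 : 0 < t - s by rewrite subr_gt0 (lt_trans sx).
rewrite /chord -(ltr_pM2r ts0) mulrDl mulrAC divfK ?gt_eqF//.
by have := cphi s x t Es Ex Et sx xt; lra.
Qed.

(** [Num.sqrt (1 + x ^+ 2)] is the Euclidean norm of the vector [(1, x)], and vectors with distinct
    [x] are not collinear, so the triangle inequality is strict. Linear growth makes the function
    integrable as soon as the mean is finite. *)
Lemma neg_sqrt1D_strictly_concave :
  strictly_concave3 setT (fun x : R => - Num.sqrt (1 + x ^+ 2)).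
Proof.
move=> x y z _ _ _ xy yz.
have h (w : R) : 0 <= 1 + w ^+ 2 by rewrite addr_ge0// sqr_ge0.
set a := Num.sqrt (1 + x ^+ 2); set b := Num.sqrt (1 + z ^+ 2);
  set c := Num.sqrt (1 + y ^+ 2).
have a0 : 0 <= a by exact: sqrtr_ge0.
have b0 : 0 <= b by exact: sqrtr_ge0.
have c0 : 0 <= c by exact: sqrtr_ge0.
have aE : a ^+ 2 = 1 + x ^+ 2 by rewrite sqr_sqrtr.
have bE : b ^+ 2 = 1 + z ^+ 2 by rewrite sqr_sqrtr.
have cE : c ^+ 2 = 1 + y ^+ 2 by rewrite sqr_sqrtr.
(* Strict Cauchy-Schwarz for [(1, x)] and [(1, z)]: the squares differ by [(z - x) ^+ 2]. *)
have abxz : 1 + x * z < a * b.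
  have [xz|xz] := ltP (1 + x * z) 0;
    first by rewrite (lt_le_trans xz)// mulr_ge0.
  rewrite -(@ltr_pXn2r _ 2)// ?nnegrE ?mulr_ge0// exprMn aE bE -subr_gt0.
  have -> : (1 + x ^+ 2) * (1 + z ^+ 2) - (1 + x * z) ^+ 2 = (z - x) ^+ 2 by
    ring.
  by rewrite exprn_gt0// subr_gt0 (lt_trans xy).
set p := z - y; set q := y - x; have p0 : 0 < p by rewrite subr_gt0.
have q0 : 0 < q by rewrite subr_gt0.
have pq : z - x = p + q by rewrite /p /q; ring.
rewrite pq !mulNr -opprD ltrN2.
rewrite -(@ltr_pXn2r _ 2)// ?nnegrE; last 2 first.
- by rewrite mulr_ge0// addr_ge0// ltW.
- by rewrite addr_ge0// mulr_ge0// ltW.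
have yE : y * (p + q) = x * p + z * q by rewrite /p /q; ring.
have -> : (c * (p + q)) ^+ 2 = (p + q) ^+ 2 + (x * p + z * q) ^+ 2.
  by rewrite exprMn cE -yE; ring.
have -> : (a * p + b * q) ^+ 2 = (1 + x ^+ 2) * p ^+ 2 + (1 + z ^+ 2) * q ^+ 2 +
  2 * p * q * (a * b).
  by rewrite -aE -bE; ring.
rewrite -subr_gt0.
have -> : (1 + x ^+ 2) * p ^+ 2 + (1 + z ^+ 2) * q ^+ 2 + 2 * p * q * (a * b) -
  ((p + q) ^+ 2 + (x * p + z * q) ^+ 2)
  = 2 * p * q * (a * b - (1 + x * z)) by ring.
by rewrite !mulr_gt0// subr_gt0.
Qed.

End chords.

(** * Measurability and integrability of concave functions *)

Section concave.
Context {R : realType}.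
Local Notation RR := (measurableTypeR R).
Variables (I : set R) (f : R -> R).
Hypothesis f_concave : convex_function (I : set R^o) ((\- f) : R^o -> R^o).

Lemma concave3_of_convex_function : concave3 I f.
Proof.
move=> x y z Ix Iy Iz xy yz.
have zx0 : 0 < z - x by rewrite subr_gt0 (lt_trans xy).
pose t := (z - y) / (z - x).
have t0 : 0 <= t by rewrite divr_ge0 ?subr_ge0 ?ltW// (lt_trans xy).
have t1 : t <= 1 by rewrite ler_pdivrMr// mul1r lerB// ltW.
have h : - f (t * x + (1 - t) * z) <= t * - f x + (1 - t) * - f z :=
  f_concave (Itv01 t0 t1) (mem_set Ix) (mem_set Iz).
have yE : t * x + (1 - t) * z = y by rewrite /t; field; rewrite gt_eqF.
rewrite yE in h.
have : t * f x + (1 - t) * f z <= f y by lra.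
rewrite -(ler_pM2r zx0); congr (_ <= _).
by rewrite /t; field; rewrite gt_eqF.
Qed.

Hypotheses (I_open : open I) (I_itv : is_interval I).

(** The sets where [f] is at least [r] are intervals by concavity. *)
Lemma measurable_fun_concave : measurable_fun (I : set RR) (f : RR -> RR).
Proof.
have mI : measurable (I : set RR) by exact: is_interval_measurable.
have cf := concave3_of_convex_function.
apply: (measurability (@RGenCInfty.G R)) => [|/= _ [_] [r] -> <-].
  exact: RGenCInfty.measurableE.
apply: is_interval_measurable => s t/=.
rewrite !in_itv/= !andbT => -[Is fs] [It ft] u /andP[su ut].
have Iu : I u by apply: (I_itv Is It); rewrite su.
split=> //; rewrite in_itv/= andbT.
move: su; rewrite [s <= u]le_eqVlt => /predU1P[<- //|su].
move: ut; rewrite [u <= t]le_eqVlt => /predU1P[-> //|ut].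
have := cf _ _ _ Is Iu It su ut.
have ts : 0 < t - s by rewrite subr_gt0 (lt_trans su).
have h1 : r * (t - u) <= f s * (t - u) by rewrite ler_wpM2r// subr_ge0 ltW.
have h2 : r * (u - s) <= f t * (u - s) by rewrite ler_wpM2r// subr_ge0 ltW.
move=> h; rewrite -(ler_pM2r ts); apply: le_trans h;
  apply: le_trans (lerD h1 h2).
by rewrite -mulrDr addrA subrK.
Qed.

Lemma integrable_concave (mu : probability RR R) : I !=set0 ->
  mu.-integrable I (fun x : R => x%:E) ->
  (\int[mu]_(x in I) (f^\- x)%:E < +oo)%E ->
  mu.-integrable I (EFin \o f).
Proof.
move=> [x0 Ix0] intx fneg; have cf := concave3_of_convex_function.
have mI : measurable (I : set RR) by exact: is_interval_measurable.
have [e /= e0 eI] : exists2 e, 0 < e & ball x0 e `<=` I.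
  by move/nbhs_ballP : (open_nbhs_nbhs (conj I_open Ix0)).
have e2 : 0 < e / 2 by rewrite divr_gt0.
pose r := x0 - e / 2; pose t := x0 + e / 2.
have Ir : I r by apply: eI; rewrite /ball/= /r opprB addrC subrK gtr0_norm//;
  lra.
have It : I t by apply: eI;
  rewrite /ball/= /t opprD addrA subrr add0r normrN gtr0_norm//; lra.
have rx : r < x0 by rewrite /r; lra.
have xt : x0 < t by rewrite /t; lra.
have intn : mu.-integrable I (EFin \o f^\-).
  apply/integrableP; split.
    by apply/measurable_EFinP/measurable_funrneg; exact: measurable_fun_concave.
  by under eq_integral do rewrite /= ger0_norm ?funrneg_ge0//.
have intL s u : mu.-integrable I (EFin \o chord f s u).
  have -> : EFin \o chord f s u = (fun x => (f s - (f u - f s) / (u - s) * s)%:E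
    +
      ((f u - f s) / (u - s))%:E * x%:E)%E.
    by apply/funext => x /=; rewrite -EFinM -EFinD /chord; congr EFin; ring.
  apply: integrableD => //; first exact: finite_measure_integrable_cst.
  exact: integrableZl.
have intB := integrableD mI intn (integrableD mI (integrable_abse (intL r x0))
  (integrable_abse (intL x0 t))).
apply: le_integrable intB => //.
  by apply/measurable_EFinP; exact: measurable_fun_concave.
move=> x Ix; change (`|f x|%:E <= `|f^\- x + (`|chord f r x0 x| + `|chord f x0 t
  x|)|%:E)%E; rewrite lee_fin.
rewrite [leRHS]ger0_norm; last by rewrite !addr_ge0.
(* A concave function lies below a chord outside the interval that the chord spans: at or left of
   [x0] the chord over [x0] and [t] serves, right of it the one over [r] and [x0]. *)
have fle : f x <= `|chord f r x0 x| + `|chord f x0 t x|.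
  have [xx0|x0x] := leP x x0.
    have := chord_outside cf Ix0 It xt Ix; rewrite ltNge xx0/= => /(_ isT) h.
    by rewrite (le_trans h)// (le_trans (ler_norm _))// lerDr.
  have := chord_outside cf Ir Ix0 rx Ix;
    rewrite [x < x0]ltNge (ltW x0x) andbF => /(_ isT) h.
  by rewrite (le_trans h)// (le_trans (ler_norm _))// lerDl.
have nf : - f x <= f^\- x by rewrite /funrneg le_max lexx.
have n0 : 0 <= f^\- x by [].
have p0 : 0 <= `|chord f r x0 x| + `|chord f x0 t x| by rewrite addr_ge0.
by rewrite ler_norml; apply/andP; split; lra.
Qed.

End concave.

Lemma integrable_neg_sqrt1D (R : realType) (mu : probability (measurableTypeR R)
  R) :
  mu.-integrable setT (EFin \o (id : R -> R)) ->
  mu.-integrable setT (EFin \o (fun x : R => - Num.sqrt (1 + x ^+ 2))).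
Proof.
move=> intx.
have int1 : mu.-integrable setT (EFin \o (cst 1 : R ->
  R)) by exact: finite_measure_integrable_cst.
have intB := integrableD measurableT int1 (integrable_abse intx).
apply: (le_integrable measurableT _ _ intB).
  apply/measurable_EFinP/measurable_funN.
  apply: (@measurableT_comp _ _ _ _ _ _ (@Num.sqrt R)).
    apply: continuous_measurable_fun. exact: sqrt_continuous.
  by apply: measurable_funD => //; exact: measurable_funX.
move=> x _; change (`|- Num.sqrt (1 + x ^+ 2)|%:E <= `|1 + `|x| |%:E)%E;
  rewrite lee_fin.
rewrite normrN ger0_norm ?sqrtr_ge0// -sqrtr_sqr ler_wsqrtr//.
by rewrite sqrrD expr1n mul1r real_normK ?num_real// lerD2r lerDl mulrn_wge0.
Qed.

(** * Signed transfers of mass that annihilate affine functions *)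

Section transfer.
Context {R : realType}.
Local Notation RR := (measurableTypeR R).
Variable P : {finite_measure set RR -> \bar R}.
Hypothesis intx : P.-integrable setT (EFin \o (id : R -> R)).
Implicit Types (u v tau phi : R -> R).

Let int1 : P.-integrable setT (EFin \o (cst 1 : R -> R)).
Proof. exact: finite_measure_integrable_cst. Qed.

Lemma integrableM_bdd tau phi : measurable_fun setT (tau : RR -> RR) ->
  (forall x, `|tau x| <= 1) -> P.-integrable setT (EFin \o phi) ->
  P.-integrable setT (EFin \o (phi \* tau)).
Proof.
move=> mtau tau1 intphi; apply: (le_integrable measurableT _ _ intphi).
  apply/measurable_EFinP; apply: measurable_funM => //.
  by apply/measurable_EFinP; exact: measurable_int intphi.
by move=> x _; rewrite /= lee_fin normrM ler_piMr.
Qed.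

Lemma unit_density_indicM (A : set RR) u : measurable A ->
  unit_density (u : RR -> R) ->
  unit_density (\1_A \* u : RR -> R).
Proof.
move=> mA [mu u01]; split=> [|x]; first by apply: measurable_funM => //;
  exact: measurable_indic.
have /andP[u0 u1] := u01 x.
by rewrite /= indicE; case: (x \in A);
  rewrite /= ?mul1r ?mul0r ?u0 ?u1 ?lexx ?ler01.
Qed.

Lemma affine_integral0 tau phi (c e : R) : measurable_fun setT (tau : RR ->
  RR) ->
  (forall x, `|tau x| <= 1) -> P.-integrable setT (EFin \o phi) ->
  \int[P]_x (1 * tau x) = 0 -> \int[P]_x (x * tau x) = 0 ->
  P.-integrable setT (EFin \o (fun x => phi x - (c + e * x))) /\
  \int[P]_x (phi x * tau x) = \int[P]_x ((phi x - (c + e * x)) * tau x).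
Proof.
move=> mtau tau1 intphi t0 tx.
have I1 := integrableM_bdd mtau tau1 int1;
  have Ix := integrableM_bdd mtau tau1 intx.
have Ip := integrableM_bdd mtau tau1 intphi.
have Ic := integrableZl measurableT c int1;
  have Ie := integrableZl measurableT e intx.
split.
  rewrite (_ : EFin \o _ = (fun x => (phi x)%:E - (c%:E * 1%:E + e%:E *
    x%:E))%E).
    exact: (integrableB measurableT intphi (integrableD measurableT Ic Ie)).
  apply/funext => x.
  by change ((phi x - (c + e * x))%:E = (phi x - (c * 1 + e * x))%:E);
    rewrite mulr1.
transitivity (\int[P]_x (phi x * tau x - (c * (1 * tau x) + e * (x * tau x))));
  last first.
  by apply: eq_Rintegral => x _; ring.
have I1c := integrableZl measurableT c I1;
  have Ixe := integrableZl measurableT e Ix.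
rewrite RintegralB//; last exact: (integrableD measurableT I1c Ixe).
rewrite RintegralD//.
rewrite (@RintegralZl _ _ _ P setT (fun x => 1 * tau x) c measurableT I1).
by rewrite (@RintegralZl _ _ _ P setT (fun x => x * tau x) e measurableT Ix) t0
  tx; ring.
Qed.

Variables (E : set R) (mE : measurable (E : set RR)).

(** [tau] adds part of [v] on the middle piece [B] and removes parts of [u] on the outer pieces [A]
    and [C]. The barycentre of the middle piece lies between those of the outer ones, so suitable
    proportions cancel both mass and first moment. *)
Lemma exists_transfer u v s t : unit_density (u : RR -> R) ->
  unit_density (v : RR -> R) -> s < t ->
  0 < \int[P]_x (1 * (\1_(E `&` [set x | x < s]) x * u x)) ->
  0 < \int[P]_x (1 * (\1_(E `&` [set x | s < x < t]) x * v x)) ->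
  0 < \int[P]_x (1 * (\1_(E `&` [set x | t < x]) x * u x)) ->
  exists tau : R -> R, [/\ measurable_fun setT (tau : RR -> RR),
    forall x, - u x <= tau x <= v x,
    forall x, (E x -> s < x < t -> 0 <= tau x) /\ (~~ (s < x < t) ->
      tau x <= 0) /\ (~ E x -> tau x = 0),
    \int[P]_x (1 * tau x) = 0 /\ \int[P]_x (x * tau x) = 0 &
    0 < \int[P]_x (1 * (\1_(E `&` [set x | s < x < t]) x * tau x))].
Proof.
move=> ud vd st.
set A := E `&` [set x | x < s]; set B := E `&` [set x | s < x < t];
  set C := E `&` [set x | t < x].
have mA : measurable (A : set RR).
  by apply: measurableI => //; have := measurable_itv `]-oo, s[;
    rewrite set_itvE.
have mB : measurable (B : set RR).
  by apply: measurableI => //; have := measurable_itv `]s, t[; rewrite set_itvE.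
have mC : measurable (C : set RR).
  by apply: measurableI => //; have := measurable_itv `]t, +oo[;
    rewrite set_itvE.
have uA := unit_density_indicM mA ud; have vB := unit_density_indicM mB vd.
have uC := unit_density_indicM mC ud.
pose J phi (w : R -> R) := \int[P]_x (phi x * w x).
set m1 := \int[P]_x _; set m := \int[P]_x _; set m2 := \int[P]_x _.
move=> m10 m0 m20.
have Jid phi w : unit_density (w : RR -> R) ->
  P.-integrable setT (EFin \o phi) ->
  P.-integrable setT (EFin \o (phi \* w)) by exact: integrableM_density.
have JC w c : unit_density (w : RR -> R) -> c * J (cst 1) w = J (cst c) w.
  move=> wd; rewrite /J -(@RintegralZl _ _ _ P setT (fun x => cst 1 x * w x) c
    measurableT).
    by apply: eq_Rintegral => x _; rewrite /= mul1r.
  exact: (Jid (cst 1)).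
have IC c : P.-integrable setT (EFin \o (cst c : R ->
  R)) by exact: finite_measure_integrable_cst.
have Jle phi psi (D : set RR) w : measurable D -> unit_density (w : RR -> R) ->
    P.-integrable setT (EFin \o phi) -> P.-integrable setT (EFin \o psi) ->
    (forall x, D x -> phi x <= psi x) -> J phi (\1_D \* w) <= J psi (\1_D \* w).
  move=> mD wd Iphi Ipsi h; have wdD := unit_density_indicM mD wd.
  apply: le_Rintegral => //; [exact: Jid|exact: Jid|].
  move=> x _ /=; rewrite indicE; case: (boolP (x \in D)) => [xD|_];
    last by rewrite mul0r !mulr0.
  by rewrite mul1r ler_wpM2r ?h//;
    [have [_ /(_ x)/andP[]] := wd|exact: set_mem].
pose M1 := J id (\1_A \* u); pose M := J id (\1_B \* v);
  pose M2 := J id (\1_C \* u).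
have M1s : M1 <= s * m1.
  have -> : s * m1 = J (cst s) (\1_A \* u) by exact: JC.
  by apply: Jle => // x [_ /ltW].
have Ms : s * m <= M.
  have -> : s * m = J (cst s) (\1_B \* v) by exact: JC.
  by apply: Jle => // x [_ /andP[/ltW]].
have Mt : M <= t * m.
  have -> : t * m = J (cst t) (\1_B \* v) by exact: JC.
  by apply: Jle => // x [_ /andP[_ /ltW]].
have M2t : t * m2 <= M2.
  have -> : t * m2 = J (cst t) (\1_C \* u) by exact: JC.
  by apply: Jle => // x [_ /ltW].
(* Barycentres of the three pieces, in the order [b1 <= s <= b <= t <= b2]. *)
pose b1 := M1 / m1; pose b := M / m; pose b2 := M2 / m2.
have b1s : b1 <= s by rewrite ler_pdivrMr.
have bs : s <= b by rewrite ler_pdivlMr.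
have bt : b <= t by rewrite ler_pdivrMr.
have b2t : t <= b2 by rewrite ler_pdivlMr.
have b12 : 0 < b2 - b1 by rewrite subr_gt0 (le_lt_trans b1s)// (lt_le_trans st).
(* The amount of mass moved; being at most each of the three masses, it keeps all proportions at
   most 1. *)
pose w := Num.min (Num.min m1 m2) m.
have w0 : 0 < w by rewrite !lt_min m10 m20.
have wm1 : w <= m1 by rewrite !ge_min lexx.
have wm2 : w <= m2 by rewrite !ge_min lexx orbT.
have wm : w <= m by rewrite !ge_min lexx orbT.
(* The mass [w] taken from the outer pieces is split by the weights that express [b] as a convex
   combination of [b1] and [b2]. *)
pose al := w * ((b2 - b) / (b2 - b1)) / m1.
pose be := w * ((b - b1) / (b2 - b1)) / m2.
pose ga := w / m.
have frac01 r m' : 0 <= r -> r <= 1 -> 0 < m' -> w <= m' ->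
  0 <= w * r / m' <= 1.
  move=> r0 r1 m'0 wm'; rewrite divr_ge0 ?mulr_ge0 ?(ltW w0) ?(ltW m'0)//=.
  by rewrite ler_pdivrMr// mul1r (le_trans _ wm')// ler_piMr// ltW.
have al01 : 0 <= al <= 1.
  apply: frac01 => //; first by rewrite divr_ge0 ?(ltW b12)//
    subr_ge0 (le_trans bt).
  by rewrite ler_pdivrMr// mul1r; lra.
have be01 : 0 <= be <= 1.
  apply: frac01 => //; first by rewrite divr_ge0 ?(ltW b12)//
    subr_ge0 (le_trans b1s).
  by rewrite ler_pdivrMr// mul1r; lra.
have ga01 : 0 < ga <= 1 by rewrite divr_gt0//= ler_pdivrMr// mul1r.
have /andP[al0 al1] := al01; have /andP[be0 be1] := be01;
  have /andP[ga0 ga1] := ga01.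
pose tau x := ga * (\1_B x * v x) - al * (\1_A x * u x) - be * (\1_C x * u x).
have u0 x : 0 <= u x by have [_ /(_ x)/andP[]] := ud.
have v0 x : 0 <= v x by have [_ /(_ x)/andP[]] := vd.
have indicP (D : set RR) x : (D x /\ \1_D x = 1 :> R) \/ (~ D x /\ \1_D x = 0 :>
  R).
  rewrite indicE; have [xD|xD] := pselect (D x); first by left; rewrite mem_set.
  by right; rewrite memNset.
have tauE x : (A x /\ tau x = - (al * u x)) \/ (B x /\ tau x = ga * v x) \/
    (C x /\ tau x = - (be * u x)) \/ ([/\ ~ A x, ~ B x & ~ C x] /\ tau x = 0).
  rewrite /tau; case: (indicP A x) => -[Ax ->]; case: (indicP B x) => -[Bx ->];
    case: (indicP C x) => -[Cx ->].
  - by case/andP: Bx.2; rewrite ltNge (ltW Ax.2).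
  - by case/andP: Bx.2; rewrite ltNge (ltW Ax.2).
  - by have := lt_trans Cx.2 (lt_trans Ax.2 st); rewrite ltxx.
  - by left; split=> //; ring.
  - by case/andP: Bx.2 => _; rewrite ltNge (ltW Cx.2).
  - by right; left; split=> //; ring.
  - by right; right; left; split=> //; ring.
  - by right; right; right; split=> //; ring.
have mtau : measurable_fun setT (tau : RR -> RR).
  have [mA' _] := uA; have [mB' _] := vB; have [mC' _] := uC.
  by apply: measurable_funB; [apply: measurable_funB|]; apply: measurable_funM.
have Jtau phi : P.-integrable setT (EFin \o phi) ->
    J phi tau = ga * J phi (\1_B \* v) - al * J phi (\1_A \* u) - be * J phi
      (\1_C \* u).
  move=> Iphi.
  have IA := Jid _ _ uA Iphi; have IB := Jid _ _ vB Iphi;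
    have IC' := Jid _ _ uC Iphi.
  have IAz := integrableZl measurableT al IA;
    have IBz := integrableZl measurableT ga IB.
  have ICz := integrableZl measurableT be IC'.
  rewrite -(@RintegralZl _ _ _ P setT _ ga measurableT IB).
  rewrite -(@RintegralZl _ _ _ P setT _ al measurableT IA).
  rewrite -(@RintegralZl _ _ _ P setT _ be measurableT IC').
  rewrite -(@RintegralB _ _ _ P setT _ _ measurableT IBz IAz).
  rewrite -(@RintegralB _ _ _ P setT _ _ measurableT (integrableB measurableT
    IBz IAz) ICz).
  by apply: eq_Rintegral => x _; rewrite /tau /=; ring.
have m1n0 : m1 != 0 by rewrite gt_eqF.
have mn0 : m != 0 by rewrite gt_eqF.
have m2n0 : m2 != 0 by rewrite gt_eqF.
have b12n0 : b2 - b1 != 0 by rewrite gt_eqF.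
exists tau; split=> //.
- move=> x; have ux := u0 x; have vx := v0 x.
  have alu : al * u x <= u x by rewrite ler_piMl.
  have beu : be * u x <= u x by rewrite ler_piMl.
  have gav : ga * v x <= v x by rewrite ler_piMl.
  have alu0 : 0 <= al * u x by rewrite mulr_ge0.
  have beu0 : 0 <= be * u x by rewrite mulr_ge0.
  have gav0 : 0 <= ga * v x by rewrite mulr_ge0// ltW.
  by have [[_ ->]|[[_ ->]|[[_ ->]|[_ ->]]]] := tauE x; apply/andP; split; lra.
- move=> x; have ux := u0 x; have vx := v0 x.
  have alu0 : 0 <= al * u x by rewrite mulr_ge0.
  have beu0 : 0 <= be * u x by rewrite mulr_ge0.
  have gav0 : 0 <= ga * v x by rewrite mulr_ge0// ltW.
  have [[[Ex xs] ->]|[[[Ex sxt] ->]|[[[Ex tx] ->]|[[nA nB nC] ->]]]] := tauE x.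
  + split=> [_ /andP[/lt_trans /(_ xs)]|]; first by rewrite ltxx.
    by split=> [_|//]; rewrite oppr_le0.
  + by split=> // ; split=> [|//]; rewrite sxt.
  + split=> [_ /andP[_ /lt_trans /(_ tx)]|]; first by rewrite ltxx.
    by split=> [_|//]; rewrite oppr_le0.
  + by [].
- split.
    change (J (cst 1) tau = 0); rewrite Jtau// -/m -/m1 -/m2.
    rewrite -[J _ (\1_B \* v)]/m -[J _ (\1_A \* u)]/m1 -[J _ (\1_C \* u)]/m2.
    rewrite /ga /al /be; field; by rewrite ?m1n0 ?mn0 ?m2n0 ?b12n0.
  change (J id tau = 0); rewrite Jtau// -/M -/M1 -/M2.
  have -> : M1 = b1 * m1 by rewrite divfK.
  have -> : M = b * m by rewrite divfK.
  have -> : M2 = b2 * m2 by rewrite divfK.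
  rewrite /ga /al /be; field; by rewrite ?m1n0 ?mn0 ?m2n0 ?b12n0.
suff -> : \int[P]_x (1 * (\1_B x * tau x)) = ga * m by rewrite mulr_gt0.
transitivity (\int[P]_x (ga * (1 * (\1_B x * v x)))); last first.
  exact: (@RintegralZl _ _ _ P setT (cst 1 \* (\1_B \* v)) ga measurableT (Jid _
    _ vB int1)).
apply: eq_Rintegral => x _ /=.
have [[Bx ->]|[_ ->]] := indicP B x; last by rewrite !mul0r !mulr0.
have [Ex /andP[sx xt]] := Bx.
have [[[_ xs] _]|[[_ ->]|[[[_ tx] _]|[[_ /(_ Bx)]]]]] := tauE x => //.
- by have := lt_trans sx xs; rewrite ltxx.
- by rewrite !mul1r.
- by have := lt_trans xt tx; rewrite ltxx.
Qed.

End transfer.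

Section gain.
Context {R : realType}.
Local Notation RR := (measurableTypeR R).
Variable P : {finite_measure set RR -> \bar R}.
Hypothesis intx : P.-integrable setT (EFin \o (id : R -> R)).
Variables (E : set R) (tau phi : R -> R) (s t : R).
Hypotheses (mE : measurable (E : set RR)) (Es : E s) (Et : E t) (st : s < t)
  (mtau : measurable_fun setT (tau : RR -> RR)) (tau1 : forall x, `|tau x| <= 1)
  (tau_sign : forall x, (E x -> s < x < t -> 0 <= tau x) /\
    (~~ (s < x < t) -> tau x <= 0) /\ (~ E x -> tau x = 0))
  (tau0 : \int[P]_x (1 * tau x) = 0) (taux : \int[P]_x (x * tau x) = 0)
  (intphi : P.-integrable setT (EFin \o phi)).

Let diff x := phi x - chord phi s t x.

Let diff_int : P.-integrable setT (EFin \o diff) /\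
  \int[P]_x (phi x * tau x) = \int[P]_x (diff x * tau x).
Proof.
pose k := (phi t - phi s) / (t - s).
have -> : diff = fun x => phi x - ((phi s - k * s) + k * x).
  by apply/funext => x; rewrite /diff /chord -/k; ring.
exact: affine_integral0.
Qed.

(** On [E], both [diff] and [tau] are nonnegative between [s] and [t] and nonpositive elsewhere; off
    [E] the factor [tau] vanishes. *)
Let diff_ge0 : concave3 E phi -> forall x, 0 <= diff x * tau x.
Proof.
move=> cphi x; have [tin [tout tE]] := tau_sign x.
have [Ex|nEx] := pselect (E x); last by rewrite tE// mulr0.
have [sxt|sxt] := boolP (s < x < t).
  by rewrite mulr_ge0 ?tin// subr_ge0; apply: chord_inside cphi _ _ _ _.
by rewrite mulr_le0 ?tout// subr_le0; apply: chord_outside cphi _ _ _ _ _.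
Qed.

(** [tau] annihilates affine functions, so [phi] may be replaced by its difference with the chord,
    whose product with [tau] is nonnegative. *)
Lemma transfer_gain_ge0 : concave3 E phi -> 0 <= \int[P]_x (phi x * tau x).
Proof.
move=> cphi; rewrite diff_int.2; apply: Rintegral_ge0 => x _.
exact: diff_ge0.
Qed.

(** A zero gain would make [diff * tau] vanish almost everywhere; as [diff] is positive on the
    middle piece, [tau] would carry no mass there. *)
Lemma transfer_gain_gt0 : strictly_concave3 E phi ->
  0 < \int[P]_x (1 * (\1_(E `&` [set x | s < x < t]) x * tau x)) ->
  0 < \int[P]_x (phi x * tau x).
Proof.
move=> sphi; have cphi := strictly_concave3W sphi.
move=> taupos; rewrite lt_def transfer_gain_ge0// andbT; apply/eqP => phi0.
have [intd dE] := diff_int; have d0 := diff_ge0 cphi.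
have intdt := integrableM_bdd mtau tau1 intd.
have : (\int[P]_x `|(diff x * tau x)%:E| = 0)%E.
  under eq_integral do rewrite gee0_abs ?lee_fin//.
  by rewrite -[LHS]fineK ?(integrable_fin_num _ intdt)// -[fine _]dE phi0.
move/(ae_eq_integral_abs P measurableT (measurable_int _ intdt)).1 => ae0.
suff E0 : \int[P]_x (1 * (\1_(E `&` [set x | s < x < t]) x * tau x)) = 0.
  by rewrite E0 ltxx in taupos.
have mB : measurable (E `&` [set x | s < x < t] : set RR).
  by apply: measurableI => //; have := measurable_itv `]s, t[; rewrite set_itvE.
rewrite /Rintegral (ae_eq_integral (cst 0%E))//.
- by rewrite integral0.
- apply/measurable_EFinP; apply: measurable_funM => //;
    apply: measurable_funM => //.
apply: filterS ae0 => x /= /(_ Logic.I) [dt] _; congr EFin;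
  rewrite mul1r indicE.
have [[Ex sxt]|nB] := pselect ((E `&` [set x | s < x < t]) x);
  last by rewrite memNset// mul0r.
have := chord_inside_lt sphi Es Et Ex sxt; rewrite -subr_gt0 -/(diff x) => dx.
move/eqP: dt; rewrite mulf_eq0 gt_eqF//= => /eqP ->.
by rewrite mulr0.
Qed.

End gain.

Lemma exists_density_measure d (T : measurableType d) (R : realType)
    (P : {finite_measure set T -> \bar R}) (h : T -> R) : unit_density h ->
  exists m : {measure set T -> \bar R}, forall A,
    m A = (\int[P]_(x in A) (h x)%:E)%E.
Proof.
move=> [mh h01]; pose m A : \bar R := (\int[P]_(x in A) (h x)%:E)%E.
have h0 x : (0 <= (h x)%:E)%E by have /andP[] := h01 x.
have m0 : m set0 = 0%E by exact: integral_set0.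
have m_ge0 A : (0 <= m A)%E by exact: integral_ge0.
have mh' : measurable_fun setT (EFin \o h) by exact/measurable_EFinP.
have msigma : semi_sigma_additive m := semi_sigma_additive_nng_induced mh' h0.
pose mm : {measure set T -> \bar R} :=
  HB.pack m (isMeasure.Build _ _ _ m m0 m_ge0 msigma).
by exists mm.
Qed.

(** * Supports relative to an interval *)

Section support.
Context {R : realType}.
Local Notation RR := (measurableTypeR R).

(** Stated for a bare set function, so that it applies directly to [A] mapped to the integral of
    [g i] over [A]; for a probability it unfolds to [msupport]. *)
Definition support_in (I : set R) (mu : set RR -> \bar R) : set R :=
  [set x | I x /\ forall U : set R, open U -> U x -> (0 < mu U)%E].

Variables (I : set R) (mu : {measure set RR -> \bar R}).
Hypothesis mI : measurable (I : set RR).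

(** An enumeration of the null open intervals with rational end points; every other code gives the
    empty set. *)
Let null_itv (k : nat) : set RR :=
  if (unpickle k : option (rat * rat)) is Some p then
    if mu `]ratr p.1, ratr p.2[%classic == 0%E then `]ratr p.1,
      ratr p.2[%classic
    else set0
  else set0.

Let mnull k : measurable (null_itv k).
Proof. by rewrite /null_itv; case: (unpickle k) => // p; case: ifP. Qed.

Let null_itv0 k : mu (null_itv k) = 0%E.
Proof. by rewrite /null_itv; case: (unpickle k) => // p;
  case: ifP => // /eqP. Qed.

(** A point with a null neighbourhood also has a null rational interval around it, so the complement
    of the support in [I] is covered by countably many null sets. *)
Let supportE : support_in I mu = I `\` \bigcup_k null_itv k.
Proof.
apply/seteqP; split=> [x [Ix xU]|x [Ix nx]]; split=> //.
  move=> [k _]; rewrite /null_itv; case: (unpickle k) => // -[q r] /=.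
  case: ifP => // /eqP qr0 xqr.
  by have := xU _ (itv_open _ _) xqr; rewrite qr0 ltxx.
move=> U oU Ux; rewrite lt_def measure_ge0 andbT; apply/eqP => U0; apply: nx.
have [e /= e0 eU] : exists2 e, 0 < e & ball x e `<=` U.
  by move/nbhs_ballP : (open_nbhs_nbhs (conj oU Ux)).
have [q qI] := @rat_in_itvoo _ (x - e) x ltac:(by rewrite ltrBlDr ltrDl).
have [r rI] := @rat_in_itvoo _ x (x + e) ltac:(by rewrite ltrDl).
move: qI rI; rewrite !in_itv/= => /andP[eq qx] /andP[xr re].
suff qr0 : mu `]ratr q, ratr r[%classic = 0%E.
  exists (pickle (q, r)); first exact: Logic.I.
  by rewrite /null_itv pickleK /fst /snd qr0 eqxx; apply/andP.
apply/le_anti; rewrite measure_ge0 andbT -U0 le_measure ?inE//.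
  exact: open_measurable.
by move=> y; rewrite /= in_itv/= => /andP[qy yr]; apply: eU;
  rewrite /ball/= ltr_norml; lra.
Qed.

Lemma measurable_support : measurable (support_in I mu : set RR).
Proof.
rewrite supportE; apply: measurableD => //; exact: bigcupT_measurable.
Qed.

Lemma support_full : mu (I `\` support_in I mu) = 0%E.
Proof.
have mN : measurable (\bigcup_k null_itv k) by exact: bigcupT_measurable.
have N0 : mu (\bigcup_k null_itv k) = 0%E.
  apply: measure_negligible => //; apply: negligible_bigcup => k.
  by exists (null_itv k); split.
apply/eqP; rewrite -measure_le0 -N0 le_measure ?inE//.
  by apply: measurableD => //; exact: measurable_support.
by rewrite supportE => x [Ix /not_andP[//|/contrapT]].
Qed.

End support.

(** * Exchange of mass between two strips *)

Section exists_strip_exchange.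
Context {R : realType}.
Local Notation RR := (measurableTypeR R).
Variables (lambda1 lambda2 : probability RR R) (n : nat) (a : 'I_n ->
  R) (I : set R).
Hypotheses (I_itv : is_interval I) (lambda2_I : lambda2 I = 1%E)
  (mean2 : lambda2.-integrable setT (EFin \o (id : R -> R))).
Implicit Types g : 'I_n -> R -> R.

Definition strip_support g i : set R :=
  support_in I (fun A => \int[lambda2]_(x in A) (g i x)%:E)%E.

Let mI : measurable (I : set RR).
Proof. exact: is_interval_measurable. Qed.

Let lambda2_NI : lambda2 (~` I) = 0%E.
Proof. by rewrite probability_setC// lambda2_I subee. Qed.

Let strip_support_gt0 g i y (U : set R) : unit_density (g i : RR -> R) ->
  strip_support g i y ->
  open U -> U y -> 0 < \int[lambda2]_x (1 * (\1_(I `&` U) x * g i x)).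
Proof.
move=> gd [_ yU] oU Uy; have := yU _ oU Uy.
have mU : measurable (U : set RR) by exact: open_measurable.
have intg : lambda2.-integrable U (EFin \o g i).
  by apply: integrableS (bdd_density_integrable lambda2 gd).
rewrite (negligible_integral (measurableC mI) mU intg lambda2_NI) setDE setCK
  setIC.
rewrite integral_density_indic ?lte_fin//; last exact: measurableI.
by under [X in _ -> 0 < X]eq_Rintegral do rewrite mul1r.
Qed.

(* Mass of the strip over [a_i] at both ends of an interval is exchanged for
   mass of the strip over [a_j] inside it, keeping totals and barycentres. *)
Lemma exists_strip_exchange g i j y1 y y2 : transport_family lambda1 lambda2 a g
  -> i != j ->
  strip_support g i y1 -> strip_support g j y -> strip_support g i y2 ->
    y1 < y < y2 ->
  exists2 g', transport_family lambda1 lambda2 a g' &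
  exists delta : (R -> R) -> R,
  [/\ forall phi k, lambda2.-integrable setT (EFin \o phi) ->
      \int[lambda2]_x (phi x * g' k x) =
      \int[lambda2]_x (phi x * g k x) + ((k == i)%:R - (k == j)%:R) * delta phi,
    forall phi, lambda2.-integrable setT (EFin \o phi) -> concave3 I phi ->
      0 <= delta phi &
    forall phi, lambda2.-integrable setT (EFin \o phi) ->
      strictly_concave3 I phi ->
      0 < delta phi].
Proof.
move=> [[gd gsum] gp gm] ij y1i yj y2i /andP[y1y yy2].
have Iy1 := y1i.1; have Iy := yj.1; have Iy2 := y2i.1.
(* The midpoints separate the three points, so each of the three pieces cut out by [s] and [t] is a
   neighbourhood of one of them and has positive mass. *)
pose s := (y1 + y) / 2; pose t := (y + y2) / 2.
have y1s : y1 < s by rewrite /s; lra.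
have sy : s < y by rewrite /s; lra.
have yt : y < t by rewrite /t; lra.
have ty2 : t < y2 by rewrite /t; lra.
have st := lt_trans sy yt.
have Is : I s by apply: (I_itv Iy1 Iy); rewrite !ltW.
have It : I t by apply: (I_itv Iy Iy2); rewrite !ltW.
have oL : open [set x : R | x < s] by exact: open_lt.
have oM : open [set x : R | s < x < t].
  by rewrite (_ : mkset _ = [set x | s < x] `&` [set x | x < t]) ?predeqE;
    [apply: openI; [exact: open_gt|exact: open_lt]|move=> x /=; split=> /andP].
have oR : open [set x : R | t < x] by exact: open_gt.
have syt : s < y < t by rewrite sy.
have [tau [mtau tau_bd tau_sign [tau0 taux] tau_gt0]] :=
  exists_transfer mean2 mI (gd i) (gd j) st
  (strip_support_gt0 (gd i) y1i oL y1s) (strip_support_gt0 (gd j) yj oM syt)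
  (strip_support_gt0 (gd i) y2i oR ty2).
have tau1 x : `|tau x| <= 1.
  have /andP[h1 h2] := tau_bd x.
  have [_ /(_ x)/andP[i0 i1]] := gd i; have [_ /(_ x)/andP[j0 j1]] := gd j.
  by rewrite ler_norml; apply/andP; split; lra.
(* [tau] is added to the density of strip [i] and subtracted from that of strip [j], which keeps the
   sum equal to 1. *)
pose c k : R := (k == i)%:R - (k == j)%:R.
pose g' k x := g k x + c k * tau x.
have ci : c i = 1 by rewrite /c eqxx (negPf ij) subr0.
have cj : c j = -1 by rewrite /c eqxx eq_sym (negPf ij) sub0r.
have ck k : k != i -> k != j -> c k = 0 by rewrite /c => /negPf -> /negPf ->;
  rewrite subrr.
have g'E phi k : lambda2.-integrable setT (EFin \o phi) ->
    \int[lambda2]_x (phi x * g' k x) =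
    \int[lambda2]_x (phi x * g k x) + c k * \int[lambda2]_x (phi x * tau x).
  move=> Iphi; have It' := integrableM_bdd mtau tau1 Iphi.
  have Ig := @integrableM_density _ RR _ lambda2 setT phi _ _ measurableT (gd k)
    Iphi.
  rewrite -(@RintegralZl _ _ _ lambda2 setT _ (c k) measurableT It').
  rewrite -(@RintegralD _ _ _ lambda2 setT _ _ measurableT Ig (integrableZl
    measurableT (c k) It')).
  by apply: eq_Rintegral => x _; rewrite /g' /=; ring.
(* With [- g i <= tau <= g j], this bounds [g i + tau] and [g j - tau] above by 1. *)
have gij x : g i x + g j x <= 1.
  rewrite -(gsum x) (bigD1 i)//= (bigD1 j) ?(eq_sym j)//= addrA lerDl sumr_ge0//
    => k _.
  by have [_ /(_ x)/andP[]] := gd k.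
exists g'.
  split.
  - split=> [k|x].
      split=> [|x].
        by apply: measurable_funD; [have [] := gd k|apply: measurable_funM].
      have /andP[h1 h2] := tau_bd x; have h3 := gij x.
      have [_ /(_ x)/andP[i0 i1]] := gd i; have [_ /(_ x)/andP[j0 j1]] := gd j.
      have [_ /(_ x)/andP[k0 k1]] := gd k.
      rewrite /g'; have [->|ki] := eqVneq k i; first by rewrite ci; lra.
      have [->|kj] := eqVneq k j; first by rewrite cj; lra.
      by rewrite ck// mul0r addr0 k0.
    rewrite /g' big_split/= gsum -mulr_suml (bigD1 i)//= (bigD1 j) ?(eq_sym
      j)//= big1 => [|k /andP[ki kj]].
      by rewrite ci cj; ring.
    exact: ck.
  - move=> k; rewrite -[RHS]gp (g'E (cst 1))//;
      last exact: finite_measure_integrable_cst.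
    by rewrite tau0 mulr0 addr0.
  - by move=> k; rewrite -[RHS]gm (g'E id)// taux mulr0 addr0.
exists (fun phi => \int[lambda2]_x (phi x * tau x)); split=> // phi Iphi cphi.
  exact: (transfer_gain_ge0 mean2 Is It st mtau tau1 tau_sign tau0 taux Iphi
    cphi).
exact: (transfer_gain_gt0 mean2 mI Is It st mtau tau1 tau_sign tau0 taux Iphi
  cphi tau_gt0).
Qed.

End exists_strip_exchange.

(** * Extreme values *)

Section order_extension.
Context {R : realType} {n : nat}.

(** Ranking by the size of the down-set is strictly increasing; multiplying by [n] and adding the
    index breaks ties without disturbing the order. *)
Lemma linear_extension (le : 'I_n -> 'I_n -> Prop) :
  (forall i, le i i) -> (forall i j k, le i j -> le j k -> le i k) ->
  (forall i j, le i j -> le j i -> i = j) ->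
  exists2 c : 'I_n -> R, injective c & forall i j,
    le i j -> i != j -> c i < c j.
Proof.
move=> le_refl le_trans le_anti.
pose below i := [set k | `[< le k i >]]%SET.
pose r (i : 'I_n) := (#|below i| * n + i)%N.
exists (fun i => (r i)%:R) => [i j /eqP|i j ij neq].
  rewrite eqr_nat /r => /eqP rij;
    have n0 : (0 < n)%N by case: n i {rij j le le_refl le_trans le_anti below r}
    => [[]|].
  have := congr1 (modn^~ n) rij; rewrite !modnMDl !modn_small//.
  exact: val_inj.
rewrite ltr_nat /r.
have lt : (#|below i| < #|below j|)%N.
  apply/proper_card/properP; split.
    apply/fintype.subsetP => k; rewrite !inE => /asboolP/asboolP ki;
      apply/asboolP/asboolP.
    exact: (le_trans _ _ _ ki ij).
  exists j; rewrite inE; first exact/asboolP.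
  by apply/asboolP => ji; rewrite (le_anti _ _ ij ji) eqxx in neq.
apply: (@leq_trans (#|below i| * n + n)%N); first by rewrite ltn_add2l.
by rewrite -mulSnr (leq_trans _ (leq_addr _ _))// leq_mul2r lt orbT.
Qed.

End order_extension.

Lemma cvg_near_cst_eq (R : realType) S (F : set_system S) (u : S ->
  R) (l c : R) :
  ProperFilter F -> u s @[s --> F] --> l -> (\forall s \near F,
    u s = c) -> l = c.
Proof.
by move=> PF ul uc; rewrite -(cvg_lim _ ul)//; apply: cvg_lim => //;
  exact: cvg_near_cst.
Qed.

Section selection.
Context {R : realType}.
Local Notation RR := (measurableTypeR R).
Variables (lambda1 lambda2 : probability RR R) (n : nat) (a : 'I_n ->
  R) (I : set R).
Hypotheses (I_itv : is_interval I) (lambda2_I : lambda2 I = 1%E)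
  (mean2 : lambda2.-integrable setT (EFin \o (id : R -> R)))
  (mass_gt0 : forall i, 0 < atom_mass lambda1 a i).
Variable f : R -> R.
Hypotheses (intf : lambda2.-integrable setT (EFin \o f)) (cf : concave3 I f).
Implicit Types g : 'I_n -> R -> R.

Local Notation family := (transport_family lambda1 lambda2 a).
Local Notation J phi g i := (\int[lambda2]_x (phi x * g i x)).

Definition transport_value g : 'rV[R]_n :=
  \row_i ((atom_mass lambda1 a i)^-1 * J f g i).

Lemma family_density : family `<=` density_family (T := RR) (n := n).
Proof. by move=> g []. Qed.

Lemma family_weakly_closed U g : UltraFilter U -> U family ->
  density_family (T := RR) g -> weak_limit (T := RR) lambda2 U g -> family g.
Proof.
move=> UU UF gd gl; have PU := @ultra_proper _ _ UU.
have lim phi i c : lambda2.-integrable setT (EFin \o phi) ->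
    (forall h, family h -> J phi h i = c) -> J phi g i = c.
  move=> Iphi hc; have Jlim : J phi h i @[h --> U] --> J phi g i by exact: gl.
  apply: (cvg_near_cst_eq PU Jlim).
  by apply: filterS UF => h; exact: hc.
split=> // i.
  by apply: (lim (cst 1)) => [|h []//]; exact: finite_measure_integrable_cst.
by apply: (lim id) => // h [].
Qed.

Lemma family_convex g h t : family g -> family h -> 0 <= t -> t <= 1 ->
  family (fun i x => t * g i x + (1 - t) * h i x) /\
  forall phi i, lambda2.-integrable setT (EFin \o phi) ->
    J phi (fun i x => t * g i x + (1 - t) * h i x) i = t * J phi g i + (1 - t) *
      J phi h i.
Proof.
move=> [[gd gs] gp gm] [[hd hs] hp hm] t0 t1.
have E phi i : lambda2.-integrable setT (EFin \o phi) ->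
    J phi (fun i x => t * g i x + (1 - t) * h i x) i = t * J phi g i + (1 - t) *
      J phi h i.
  move=> Iphi.
  have Ig := @integrableM_density _ RR _ lambda2 setT phi _ _ measurableT (gd i)
    Iphi.
  have Ih := @integrableM_density _ RR _ lambda2 setT phi _ _ measurableT (hd i)
    Iphi.
  rewrite -(@RintegralZl _ _ _ lambda2 setT _ t measurableT Ig).
  rewrite -(@RintegralZl _ _ _ lambda2 setT _ (1 - t) measurableT Ih).
  rewrite -(@RintegralD _ _ _ lambda2 setT _ _ measurableT
    (integrableZl measurableT t Ig) (integrableZl measurableT (1 - t) Ih)).
  by apply: eq_Rintegral => x _ /=; ring.
split=> //; split.
- split=> [i|x].
    split=> [|x].
      apply: measurable_funD; apply: measurable_funM => //;
        first by have [] := gd i.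
      by have [] := hd i.
    have [_ /(_ x)/andP[g0 g1]] := gd i; have [_ /(_ x)/andP[h0 h1]] := hd i.
    have t1' : 0 <= 1 - t by rewrite subr_ge0.
    rewrite addr_ge0 ?mulr_ge0//=.
    have := ler_wpM2l t0 g1; have := ler_wpM2l t1' h1; lra.
  by rewrite big_split/= -!mulr_sumr gs hs; ring.
- move=> i; rewrite (E (cst 1)); last exact: finite_measure_integrable_cst.
  by rewrite gp hp; ring.
- by move=> i; rewrite (E id)// gm hm; ring.
Qed.

Lemma compact_transport_value : compact (transport_value @` family).
Proof.
apply: (@weak_compact_image _ RR _ lambda2 _ _ _ transport_value family_density)
  => U g UU UF gd gl.
split; first exact: family_weakly_closed UF gd gl.
apply: cvg_rV => i; rewrite mxE; under eq_fun do rewrite mxE.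
by apply: cvgMr; exact: gl.
Qed.

Lemma convex_transport_value : convex_set (transport_value @` family).
Proof.
apply/convex_setP => _ _ t [g Fg <-] [h Fh <-] t0 t1.
have [Fgh E] := family_convex Fg Fh t0 t1.
exists (fun i x => t * g i x + (1 - t) * h i x) => //.
by apply/rowP => i; rewrite !mxE E//; ring.
Qed.

Lemma extreme_transport_value_curtain e : extreme_point (transport_value @`
  family) e ->
  exists2 g, family g /\ transport_value g = e & forall i j y1 y y2 y1' y2' (y'
    : R), i != j ->
    strip_support lambda2 I g i y1 -> strip_support lambda2 I g i y ->
      strip_support lambda2 I g i y2 ->
    strip_support lambda2 I g j y1' -> strip_support lambda2 I g j y' ->
      strip_support lambda2 I g j y2' ->
    y1 < y' < y2 -> ~ y1' < y < y2'.
Proof.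
move=> [Ke ext].
set K := transport_value @` family in Ke ext *.
have cK := (convex_setP K).1 convex_transport_value.
pose d i : 'rV[R]_n := (atom_mass lambda1 a i)^-1 *: delta_mx 0 i.
pose le i j := exists2 t, 0 < t & K (e + t *: (d i - d j)).
have [|||c c_inj c_mono] := @linear_extension R n le.
- by move=> i; exists 1 => //; rewrite subrr scaler0 addr0.
- move=> i j k [t t0 Kt] [s s0 Ks].
  have ts0 : 0 < t + s by rewrite addr_gt0.
  have h0 : 0 <= s / (t + s) by rewrite divr_ge0 ?ltW.
  have h1 : s / (t + s) <= 1 by rewrite ler_pdivrMr// mul1r lerDr ltW.
  exists (t * s / (t + s)); first by rewrite divr_gt0 ?mulr_gt0.
  suff -> : e + (t * s / (t + s)) *: (d i - d k) =
      (s / (t + s)) *: (e + t *: (d i - d j)) + (1 - s / (t + s)) *: (e + s *: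
        (d j - d k)).
    exact: cK.
  apply/rowP => m; rewrite !mxE; set di := _^-1 * _; set dj := _^-1 * _;
    set dk := _^-1 * _.
  field; by rewrite gt_eqF.
- move=> i j [t t0 Kt] [s s0 Ks]; apply/eqP/negPn/negP => ij.
  pose r := Num.min t s; have r0 : 0 < r by rewrite lt_min t0.
  have shrink u v : 0 < u -> r <= u -> K (e + u *: v) -> K (e + r *: v).
    move=> u0 ru Ku.
    have h0 : 0 <= r / u by rewrite divr_ge0 ?ltW.
    have h1 : r / u <= 1 by rewrite ler_pdivrMr// mul1r.
    suff -> : e + r *: v = (r / u) *: (e + u *: v) + (1 - r / u) *: e by exact:
      cK.
    by apply/rowP => m; rewrite !mxE; field; rewrite gt_eqF.
  have rt : r <= t by rewrite ge_min lexx.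
  have rs : r <= s by rewrite ge_min lexx orbT.
  have : r *: (d i - d j) = 0.
    apply: ext; first exact: shrink Kt.
    by have := shrink _ _ s0 rs Ks; rewrite -[d j - d i]opprB scalerN.
  move/rowP => /(_ i); rewrite !mxE !eqxx (negPf ij)/= mulr0 subr0 mulr1.
  by apply/eqP; rewrite mulf_neq0 ?invr_neq0 ?gt_eqF.
pose F (x : R) := - Num.sqrt (1 + x ^+ 2).
have intF : lambda2.-integrable setT (EFin \o F) by exact:
  integrable_neg_sqrt1D.
have sF : strictly_concave3 I F.
  by move=> x y z *; exact: neg_sqrt1D_strictly_concave.
pose Psi g := \sum_i c i * J F g i.
pose fiber := [set g | family g /\ transport_value g = e].
have PsiC : compact (Psi @` fiber).
  apply: (@weak_compact_image _ RR _ lambda2 _ fiber _ Psi) => [g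
    [/family_density]//|U g UU UF gd gl].
  have UF' : U family by apply: filterS UF => h [].
  split; last by apply: cvg_sum_ord => i; apply: cvgMr; exact: gl.
  split; first exact: family_weakly_closed UF' gd gl.
  have PU := @ultra_proper _ _ UU.
  apply/rowP => i; rewrite !mxE.
  have fcvg : (atom_mass lambda1 a i)^-1 * J f h i @[h --> U] -->
      (atom_mass lambda1 a i)^-1 * J f g i by apply: cvgMr; exact: gl.
  apply: (cvg_near_cst_eq PU fcvg); apply: filterS UF => h [_ /rowP/(_ i)].
  by rewrite mxE.
have [g [Fg ge] gmax] : exists2 g, fiber g & forall h,
  fiber h -> Psi h <= Psi g.
  have [g0 Fg0 g0e] := Ke.
  have [||_ /set_mem[g Fg <-] gmax] :=
    @compact_EVT_max R R id (Psi @` fiber) _ PsiC.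
  - by exists (Psi g0); exists g0.
  - by apply: continuous_subspaceT => x; exact: cvg_id.
  by exists g => // h Fh; apply: gmax; apply/mem_set; exists h.
have lens i j y1 y y2 : i != j -> strip_support lambda2 I g i y1 ->
  strip_support lambda2 I g j y ->
    strip_support lambda2 I g i y2 -> y1 < y < y2 -> c i < c j.
  move=> ij y1i yj y2i y1y2.
  have [g' Fg' [delta [g'E delta_ge0 delta_gt0]]] :=
    exists_strip_exchange I_itv lambda2_I mean2 Fg ij y1i yj y2i y1y2.
  have df0 := delta_ge0 _ intf cf; have dF0 := delta_gt0 _ intF sF.
  have g'e : transport_value g' = e + delta f *: (d i - d j).
    rewrite -ge; apply/rowP => k; rewrite !mxE g'E//.
    have [->|ki] := eqVneq k i; first by rewrite (negPf ij) /=; ring.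
    by have [->|kj] := eqVneq k j; rewrite /=; ring.
  move: df0; rewrite le_eqVlt => /predU1P[df0|df0]; last first.
    by apply: c_mono => //; exists (delta f) => //; exists g'.
  have Fg'e : fiber g' by split=> //; rewrite g'e -df0 scale0r addr0.
  have := gmax _ Fg'e.
  have -> : Psi g' = Psi g + (c i - c j) * delta F.
    rewrite /Psi; under eq_bigr do rewrite g'E// mulrDr.
    rewrite big_split/=; congr (_ + _).
    rewrite (bigD1 i)//= (bigD1 j) ?(eq_sym j)//= big1 => [|k /andP[/negPf ->
      /negPf ->]]; last first.
      by rewrite subrr mul0r mulr0.
    by rewrite !eqxx ?(eq_sym j) (negPf ij) /=; ring.
  rewrite gerDl pmulr_lle0// subr_le0 le_eqVlt => /predU1P[/c_inj cij|//].
  by rewrite cij eqxx in ij.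
exists g => // i j y1 y y2 y1' y2' y' ij y1i yi y2i y1j yj y2j yl yr.
have := lens _ _ _ _ _ ij y1i yj y2i yl.
have ji : j != i by rewrite eq_sym.
by move/lt_trans => /(_ _ (lens _ _ _ _ _ ji y1j yi y2j yr)); rewrite ltxx.
Qed.

End selection.

Section curtain.
Context {R : realType}.
Local Notation RR := (measurableTypeR R).
Variables (lambda1 lambda2 : probability RR R) (n : nat) (a : 'I_n ->
  R) (I : set R).
Hypotheses (I_itv : is_interval I) (lambda2_I : lambda2 I = 1%E) (a_inj :
  injective a)
  (aI : range a `<=` I) (a_full : lambda1 (~` range a) = 0%E)
  (mean1 : lambda1.-integrable setT (EFin \o (id : R -> R)))
  (mean2 : lambda2.-integrable setT (EFin \o (id : R -> R))).

Let mI : measurable (I : set RR).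
Proof. exact: is_interval_measurable. Qed.

Let strip_support_full (g : 'I_n -> R -> R) i : unit_density (g i : RR -> R) ->
  measurable (strip_support lambda2 I g i : set RR) /\
  (\int[lambda2]_(x in strip_support lambda2 I g i) (g i x)%:E = \int[lambda2]_x
    (g i x)%:E)%E.
Proof.
move=> gd; have [m mE] := exists_density_measure lambda2 gd.
have cE : strip_support lambda2 I g i = support_in I m.
  by rewrite /strip_support; congr support_in; apply/funext => A; rewrite mE.
have mc : measurable (strip_support lambda2 I g i : set RR).
  by rewrite cE; exact: measurable_support.
split=> //; rewrite -!mE.
have mNI : m (~` I) = 0%E.
  have PNI : lambda2 (~` I) = 0%E by rewrite probability_setC// lambda2_I subee.
  rewrite mE; apply: null_set_integral PNI; first exact: measurableC.
  by apply/measurable_EFinP/measurable_funTS; have [] := gd.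
have mD : measurable (I `\` strip_support lambda2 I g i : set RR) by exact:
  measurableD.
have mS : m (I `\` strip_support lambda2 I g i) = 0%E by rewrite cE;
  exact: support_full.
have m0 : m (~` I `|` I `\` strip_support lambda2 I g i) = 0%E.
  by rewrite measureU0//; exact: measurableC.
have -> : [set: R] = strip_support lambda2 I g i `|` (~` I `|` I `\`
  strip_support lambda2 I g i).
  apply/seteqP; split=> // x _.
  have [cx|ncx] := pselect (strip_support lambda2 I g i x); first by left.
  by right; have [Ix|nIx] := pselect (I x); [right|left].
by rewrite measureU0//; apply: measurableU => //; exact: measurableC.
Qed.

Lemma curtain_of_strip_supports (g : 'I_n -> R ->
  R) : transport_family lambda1 lambda2 a g ->
  (forall i j y1 y y2 y1' y2' (y' : R), i != j ->
    strip_support lambda2 I g i y1 -> strip_support lambda2 I g i y ->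
      strip_support lambda2 I g i y2 ->
    strip_support lambda2 I g j y1' -> strip_support lambda2 I g j y' ->
      strip_support lambda2 I g j y2' ->
    y1 < y' < y2 -> ~ y1' < y < y2') ->
  exists2 nu, curtain_martingale_transport I lambda1 lambda2 nu &
    coupling_density lambda2 a nu g.
Proof.
move=> Fg gcurtain; have [[gd _] _ _] := Fg.
have [nu [nuM nug nuE]] := density_has_transport a_inj a_full mean2 mean1 Fg.
exists nu => //; split=> //.
pose c i := strip_support lambda2 I g i.
pose Gamma : set (RR * RR)%type :=
  \bigcup_(i in [set: 'I_n]) ([set a i] `*` c i).
have GammaE i y : Gamma (a i, y) <-> c i y.
  split=> [[j Tj] [/= aij cjy]|ciy]; last by exists i.
  by rewrite (a_inj aij).
have mGamma : measurable Gamma.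
  apply: fin_bigcup_measurable => // i _; apply: measurableX;
    first exact: measurable_set1.
  by have [] := strip_support_full (gd i).
exists Gamma; split=> //.
- move=> [x y] [i _ [/= xi ciy]]; split=> /=; last exact: ciy.1.
  by apply: aI; exists i.
- rewrite -(probability_setT nu) !nuE//; apply: eq_bigr => i _.
  rewrite preimage_setT -(strip_support_full (gd i)).2; congr (integral _ _ _).
  by apply/seteqP; split=> y /GammaE.
- move=> x y y1 y2 x' y' y1' y2' [sub xx' yy yy'].
  have Gin w : [set (x, y); (x, y1); (x, y2); (x', y'); (x', y1');
    (x', y2')] w -> Gamma w by exact: sub.
  have [i _ [/= xi _]] : Gamma (x, y) by apply: Gin => /=; tauto.
  have [j _ [/= xj _]] : Gamma (x', y') by apply: Gin => /=; tauto.
  subst x x'; have ij : i != j by apply: contraNN xx' => /eqP ->.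
  apply: (gcurtain i j y1 y y2 y1' y2' y' ij) => //; apply/GammaE/Gin => /=;
    tauto.
Qed.

End curtain.

Lemma convex_hull_convex (R : numDomainType) (M : lmodType R) (A : set M) :
  convex_set (convex_hull A).
Proof.
move=> x y l /set_mem hx /set_mem hy; apply/mem_set => C [cC AC].
by apply/set_mem/cC; apply/mem_set; [exact: hx|exact: hy].
Qed.

Lemma integrable_full (R : realType) (mu : probability (measurableTypeR R) R) (I
  : set R)
    (f : R -> R) : measurable (I : set (measurableTypeR R)) -> mu I = 1%E ->
  measurable_fun setT (f : measurableTypeR R -> measurableTypeR R) ->
  mu.-integrable I (EFin \o f) -> mu.-integrable setT (EFin \o f).
Proof.
move=> mI muI mf intf.
have muNI : mu (~` I) = 0%E by rewrite probability_setC// muI subee.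
apply/(negligible_integrable (measurableC mI) measurableT _ muNI);
  last by rewrite setTD setCK.
exact/measurable_EFinP.
Qed.

Unset Implicit Arguments.

Theorem theorem2p24 (R : realType) (I : set R)
    (lambda1 lambda2 : probability (measurableTypeR R) R)
    (f : R -> R) (n : nat) (a : 'I_n -> R)
    (I_nonempty : I !=set0) (I_open : open I) (I_itv : is_interval I)
    (lambda1_I : lambda1 I = 1%E) (lambda2_I : lambda2 I = 1%E)
    (mean1 : finite_mean I lambda1) (mean2 : finite_mean I lambda2)
    (order12 : convex_order I lambda1 lambda2)
    (f_concave : convex_function (I : set R^o) ((\- f) : R^o -> R^o))
    (f_neg : (\int[lambda2]_(x in I) (f^\- x)%:E < +oo)%E)
    (a_inj : injective a) (supp1 : msupport I lambda1 = range a) :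
  let X : set 'rV[R]_n :=
    [set cond_integrals I f a nu | nu in martingale_transport lambda1 lambda2] in
  let E : set 'rV[R]_n :=
    [set cond_integrals I f a nu | nu in
       curtain_martingale_transport I lambda1 lambda2] in
  [/\ (* the integrals defining X and E exist and are finite *)
      forall nu, martingale_transport lambda1 lambda2 nu ->
        forall i, (cond_law nu (a i)).-integrable I (EFin \o f),
      convex_set X,
      compact X &
      X = convex_hull E].
Proof.
move=> X E.
have mI : measurable (I : set (measurableTypeR R)) by exact:
  is_interval_measurable.
have aI : range a `<=` I by rewrite -supp1 => x [].
have mrange : measurable (range a : set (measurableTypeR R)) by exact:
  measurable_finite_range.
have a_full : lambda1 (~` range a) = 0%E.
  have s0 : lambda1 (I `\` range a) = 0%E by rewrite -supp1;
    exact: support_full.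
  have NI0 : lambda1 (~` I) = 0%E by rewrite probability_setC// lambda1_I subee.
  have mD : measurable (I `\` range a : set (measurableTypeR R)) by exact:
    measurableD.
  have U0 : lambda1 (~` I `|` I `\` range a) = 0%E.
    by rewrite measureU0//; exact: measurableC.
  apply/eqP; rewrite -measure_le0 -U0 le_measure ?inE//.
  - exact: measurableC.
  - by apply: measurableU => //; exact: measurableC.
  - by move=> x nx; have [Ix|nIx] := pselect (I x); [right|left].
have mass_gt0 i : 0 < atom_mass lambda1 a i.
  have [_ apos] : msupport I lambda1 (a i) by rewrite supp1; exists i.
  pose O := ~` (a @` [set j | j != i]).
  have oO : open O.
    apply: closed_openC; apply: (compact_closed (@norm_hausdorff _ _)).
    by apply: finite_compact; apply: finite_image; exact: finite_finset.
  have Oai : O (a i) by move=> [j /= ji /a_inj ij]; rewrite ij eqxx in ji.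
  have mO : measurable (O : set (measurableTypeR R)) by exact: open_measurable.
  have Opos := apos _ oO Oai.
  rewrite /atom_mass fine_gt0// ltey_eq fin_num_measure//= andbT.
  apply: (lt_le_trans Opos).
  have <- : lambda1 ([set a i] `|` ~` range a) = lambda1 [set a i].
    by rewrite measureU0//; exact: measurableC.
  rewrite le_measure ?inE//.
    by apply: measurableU => //; exact: measurableC.
  move=> x nx; have [[j _ jx]|nr] := pselect (range a x); last by right.
  left; have [->|ji] := eqVneq i j; first by rewrite -jx.
  by case: nx; exists j => //=; rewrite eq_sym.
have mid : measurable_fun setT (id : measurableTypeR R ->
  measurableTypeR R) by exact: measurable_id.
have mean1' := integrable_full mI lambda1_I mid mean1.
have mean2' := integrable_full mI lambda2_I mid mean2.
pose f' := f \_ I.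
have f'E : (EFin \o f) \_ I = EFin \o f' by rewrite restrict_EFin.
have intf' : lambda2.-integrable setT (EFin \o f').
  rewrite -f'E; apply/(integrable_mkcond _ mI).
  exact: integrable_concave.
have cf' : concave3 I f'.
  move=> x y z Ix Iy Iz; rewrite /f' !patchE !mem_set//.
  exact: concave3_of_convex_function.
have valueE nu g : martingale_transport lambda1 lambda2 nu ->
    transport_family lambda1 lambda2 a g -> coupling_density lambda2 a nu g ->
    (forall i, (cond_law nu (a i)).-integrable I (EFin \o f)) /\
    cond_integrals I f a nu = transport_value lambda1 lambda2 a f' g.
  move=> [nu1 _ _] [[gd _] _ _] nug.
  have H i := integral_cond_law nu1 nug (gd i) intf'.
  split=> [i|].
    by apply/(integrable_mkcond _ mI); rewrite f'E; exact: (H i).1.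
  by apply/rowP => i; rewrite !mxE -(H i).2 Rintegral_mkcond.
have XE : X = transport_value lambda1 lambda2 a f' @` transport_family lambda1
  lambda2 a.
  apply/seteqP; split=> [_ [nu nuM <-]|_ [g Fg <-]].
    have [g Fg nug] := transport_has_density a_inj a_full mean2' nuM.
    by exists g => //; rewrite (valueE nu g nuM Fg nug).2.
  have [nu [nuM nug _]] := density_has_transport a_inj a_full mean2' mean1' Fg.
  by exists nu => //; exact: (valueE nu g nuM Fg nug).2.
have cX : convex_set X by rewrite XE; exact: convex_transport_value.
have kX : compact X by rewrite XE; exact: compact_transport_value.
have EX : E `<=` X by move=> _ [nu [nuM _] <-]; exists nu.
split=> //.
  move=> nu nuM; have [g Fg nug] :=
    transport_has_density a_inj a_full mean2' nuM.
  exact: (valueE nu g nuM Fg nug).1.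
apply/seteqP; split; last by move=> x; apply.
apply: compact_convex_sub => //; first exact: convex_hull_convex.
rewrite XE => e /(extreme_transport_value_curtain I_itv lambda2_I mean2'
  mass_gt0 intf' cf').
move=> [g [Fg <-] gcurtain] C [_]; apply.
have [nu nuC nug] := curtain_of_strip_supports I_itv lambda2_I a_inj aI a_full
  mean1' mean2' Fg gcurtain.
by exists nu => //; exact: (valueE nu g nuC.1 Fg nug).2.
Qed.
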